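(* Let $p\ge 1$ and let $E$ be a Banach lattice satisfying the lower $p$-estimate with constant $M$. Then $E_{[p]}$ is lattice isomorphic to an AL-space. Furthermore, if $M=1$ then $E_{[p]}$ is an AL-space.
   Context: All Banach lattices are real. A Banach lattice $E$ satisfies the lower $p$-estimate with constant $M>0$ if $\bigl\|\sum_{k=1}^n x_k\bigr\|\ge\frac1M\bigl(\sum_{k=1}^n\|x_k\|^p\bigr)^{1/p}$ whenever $x_1,\dots,x_n\in E$ are (pairwise) disjoint. An AL-space is a Banach lattice with $\|x+y\|=\|x\|+\|y\|$ for all $x,y\ge 0$ (the zero space is allowed). Functional calculus: for $x_1,\dots,x_n$ in a Banach lattice $E$ there is a unique lattice homomorphism $\tau$ from the space of continuous homogeneous functions $f\colon\mathbb R^n\to\mathbb R$ (homogeneous: $f(\lambda t)=\lambda f(t)$ for all $\lambda\ge 0$) to $E$ sending the $i$-th coordinate function to $x_i$; one writes $f(x_1,\dots,x_n)=\tau(f)$. Convention: for $t\in\mathbb R$ and $p>0$, $t^p$ means $|t|^p\operatorname{sign}t$. $p$-concavification: on $E$ define new operations $x\oplus y=(x^p+y^p)^{1/p}$ and $\alpha\odot x=\alpha^{1/p}x$ ($x,y\in E$, $\alpha\in\mathbb R$), with the signed-power convention. With these operations and the original order $E$ is a vector lattice, and $\|x\|_{(p)}=\inf\{\sum_{i=1}^n\|v_i\|^p : |x|\le v_1\oplus\dots\oplus v_n,\ v_i\ge 0\}$ is a lattice seminorm on it. The resulting seminormed vector lattice is $E_{(p)}$. $E_{[p]}$ denotes the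 Banach lattice that is the completion of the normed lattice $E_{(p)}/\ker\|\cdot\|_{(p)}$. *)

(* Defs.v *)
From HB Require Import structures.
From mathcomp Require Import all_boot all_order all_algebra.
From mathcomp Require Import all_classical all_reals all_analysis.
Set Implicit Arguments.
Unset Strict Implicit.
Unset Printing Implicit Defensive.
Import Order.TTheory GRing.Theory Num.Theory.
Import numFieldNormedType.Exports.
Local Open Scope classical_set_scope.
Local Open Scope ring_scope.

(* The order of a vector lattice is part of the mixin rather than an instance
   of [Order.Lattice]: structures extending both the order hierarchy and the
   normed modules are rejected by Hierarchy Builder, because [numDomainType]
   already joins orders and norms without the missing intermediate joins. *)
HB.mixin Record isVectorLattice (R : realType) E & GRing.Lmodule R E := {
  vle : rel E ;
  vjoin : E -> E -> E ;
  vmeet : E -> E -> E ;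
  vle_refl : reflexive vle ;
  vle_anti : antisymmetric vle ;
  vle_trans : transitive vle ;
  vle_joinl : forall x y z : E, vle (vjoin x y) z = vle x z && vle y z ;
  vle_meetr : forall x y z : E, vle z (vmeet x y) = vle z x && vle z y ;
  vle_add : forall x y z : E, vle x y -> vle (x + z) (y + z) ;
  vle_scale : forall (a : R) (x y : E),
    0 <= a -> vle x y -> vle (a *: x) (a *: y)
}.

#[short(type="vectorLatticeType")]
HB.structure Definition VectorLattice (R : realType) :=
  {E of GRing.Lmodule R E & isVectorLattice R E}.

Definition modulus (R : realType) (E : vectorLatticeType R) (x : E) : E :=
  vjoin x (- x).

(* Here `|x| is the norm of x; the lattice modulus is [modulus x]. *)
HB.mixin Record VectorLattice_isBanachLattice (R : realType) E
    & CompleteNormedModule R E & VectorLattice R E := {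
  lattice_norm : forall x y : E,
    vle (modulus x) (modulus y) -> `|x| <= `|y|
}.

#[short(type="banachLatticeType")]
HB.structure Definition BanachLattice (R : realType) :=
  {E of CompleteNormedModule R E & VectorLattice R E
      & VectorLattice_isBanachLattice R E}.

Definition disjoint_elts (R : realType) (E : vectorLatticeType R) (x y : E) :
    Prop :=
  vmeet (modulus x) (modulus y) = 0.

Definition lower_estimate (R : realType) (E : banachLatticeType R) (p M : R) :
    Prop :=
  0 < M /\
  forall (n : nat) (x : 'I_n -> E),
    (forall i j, i != j -> disjoint_elts (x i) (x j)) ->
    M^-1 * (\sum_(i < n) `|x i| `^ p) `^ p^-1 <= `|\sum_(i < n) x i|.

Definition is_AL_space (R : realType) (E : banachLatticeType R) : Prop :=
  forall x y : E, vle 0 x -> vle 0 y -> `|x + y| = `|x| + `|y|.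

(* The continuity of [f] and [g] is automatic (positive operators between
   Banach lattices are bounded); it is recorded so that the relation visibly
   includes the equivalence of the two norms. *)
Definition lattice_isomorphic (R : realType) (E F : banachLatticeType R) :
    Prop :=
  exists (f : E -> F) (g : F -> E),
    [/\ linear f,
        forall x y, f (vjoin x y) = vjoin (f x) (f y),
        forall x y, f (vmeet x y) = vmeet (f x) (f y),
        cancel f g /\ cancel g f
      & continuous f /\ continuous g].

Definition cont_homogeneous (R : realType) (n : nat) : set ('rV[R]_n -> R) :=
  [set f | continuous f /\
           forall (a : R) (t : 'rV[R]_n), 0 <= a -> f (a *: t) = a * f t].

(* Lattice homomorphisms on the vector lattice [@cont_homogeneous R n], with
   values in E, sending the i-th coordinate function to [x i]; the values of
   [tau] outside this vector lattice are irrelevant. *)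
Definition is_functional_calculus (R : realType) (E : vectorLatticeType R)
    (n : nat) (x : 'I_n -> E) (tau : ('rV[R]_n -> R) -> E) : Prop :=
  [/\ forall (a : R) f g, cont_homogeneous f -> cont_homogeneous g ->
        tau (fun t => a * f t + g t) = a *: tau f + tau g,
      forall f g, cont_homogeneous f -> cont_homogeneous g ->
        tau (fun t => Num.max (f t) (g t)) = vjoin (tau f) (tau g),
      forall f g, cont_homogeneous f -> cont_homogeneous g ->
        tau (fun t => Num.min (f t) (g t)) = vmeet (tau f) (tau g)
    & forall i : 'I_n, tau (fun t => t ord0 i) = x i].

(* f(x_1, ..., x_n): in a Banach lattice such a [tau] exists, and it is unique
   on [@cont_homogeneous R n], so the default value of [xget] is never used. *)
Definition fun_calculus (R : realType) (E : banachLatticeType R) (n : nat)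
    (x : 'I_n -> E) (f : 'rV[R]_n -> R) : E :=
  xget (fun=> 0) [set tau | is_functional_calculus x tau] f.

Definition signed_pow (R : realType) (t p : R) : R :=
  Num.sg t * `|t| `^ p.

Section Concavification.
Variables (R : realType) (E : banachLatticeType R) (p : R).

Definition conc_add (x y : E) : E :=
  fun_calculus (fun i : 'I_2 => if i == ord0 then x else y)
    (fun t => signed_pow
       (signed_pow (t ord0 ord0) p + signed_pow (t ord0 ord_max) p) p^-1).

Definition conc_scale (a : R) (x : E) : E := signed_pow a p^-1 *: x.

(* The zero of E is also the zero of the concavification, hence the unit of
   the iterated operation. *)
Definition conc_seminorm (x : E) : R :=
  inf [set r | exists v : seq E,
    [/\ forall y, y \in v -> vle 0 y,
        vle (modulus x) (\big[conc_add/0]_(y <- v) y)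
      & r = \sum_(y <- v) `|y| `^ p]].

(* [F] together with [j] is the norm completion of the quotient of the
   concavification by the kernel of its seminorm. As [j] is linear for the
   concavified operations and `|j x| = conc_seminorm x, two elements of E have
   the same image iff they agree modulo that kernel, so that [j] amounts to an
   isometric lattice embedding of the quotient into [F], with dense range.
   This determines (F, j) up to an isometric lattice isomorphism. *)
Definition is_concavification_completion (F : banachLatticeType R)
    (j : E -> F) : Prop :=
  [/\ (forall x y, j (conc_add x y) = j x + j y) /\
      (forall a x, j (conc_scale a x) = a *: j x),
      forall x y, j (vjoin x y) = vjoin (j x) (j y),
      forall x y, j (vmeet x y) = vmeet (j x) (j y),
      forall x, `|j x| = conc_seminorm x
    & dense (range j)].

End Concavification.

(* Main.v *)
(** The theorem rests on the inequality

      sum_i ||u_i|| <= M^p ||sum_i u_i||     (u_i >= 0 in E_[p]).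

    If w_1, ..., w_n lie in [0, v] in E and their images in E_[p] sum up to at
    most the image of v, then v can be cut into disjoint components e_t such
    that, up to a remainder of small norm, w_i is d_it e_t on e_t.  The cuts
    are placed at levels of w_i / v around which v has little norm; these exist
    because the pieces of v around different levels are disjoint, so that the
    lower estimate applies to them.  As sum_i d_it^p <= 1 whenever e_t survives
    in E_[p], the lower estimate for the e_t bounds the sum of the seminorms of
    the w_i by M^p ||v||^p.  Riesz decomposition along a cover
    |x| <= v_1 + ... + v_m in E_(p), followed by density, gives the inequality.

    Consequently, sup { sum_i ||u_i|| : u_i >= 0, sum_i u_i = |x| } is a lattice
    norm on E_[p] that lies between ||x|| and M^p ||x|| and is additive on the
    positive cone.  The functional calculus enters only through
    x <= x (+) 0 for x >= 0, which yields ||x||_(p) <= ||x||^p. *)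
Require Import Defs.
From HB Require Import structures.
From mathcomp Require Import all_boot all_order all_algebra.
From mathcomp Require Import all_classical all_reals all_analysis.
From mathcomp Require Import zify ring lra.
Import Order.TTheory GRing.Theory Num.Theory.
Import numFieldNormedType.Exports.
Local Open Scope classical_set_scope.
Local Open Scope ring_scope.
Set Implicit Arguments.
Unset Strict Implicit.
Unset Printing Implicit Defensive.

#[local] Arguments vle_trans {R s y x z} _ _.

(** * Vector lattices *)

Section VectorLatticeTheory.
Variables (R : realType) (E : vectorLatticeType R).
Implicit Types (x y z t : E) (a b : R).

Definition vpos x : E := vjoin x 0.

Lemma vle_antisym x y : vle x y -> vle y x -> x = y.
Proof. by move=> xy yx; apply: vle_anti; rewrite xy. Qed.

Lemma vle_add2r z x y : vle (x + z) (y + z) = vle x y.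
Proof.
apply/idP/idP => [h|]; last exact: vle_add.
by have := vle_add _ _ (- z) h; rewrite !addrK.
Qed.

Lemma vle_add2l z x y : vle (z + x) (z + y) = vle x y.
Proof. by rewrite !(addrC z) vle_add2r. Qed.

Lemma vleD x y z t : vle x y -> vle z t -> vle (x + z) (y + t).
Proof.
by move=> xy zt; apply: (@vle_trans _ _ (y + z)); rewrite ?vle_add2r ?vle_add2l.
Qed.

Lemma vsub_ge0 x y : vle 0 (y - x) = vle x y.
Proof. by rewrite -(vle_add2r x) add0r subrK. Qed.

Lemma vle_subl_addr x y z : vle (x - y) z = vle x (z + y).
Proof. by rewrite -(vle_add2r y) subrK. Qed.

Lemma vle_subr_addr x y z : vle x (y - z) = vle (x + z) y.
Proof. by rewrite -(vle_add2r z) subrK. Qed.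

Lemma vleN2 x y : vle (- x) (- y) = vle y x.
Proof. by rewrite -vsub_ge0 opprK addrC vsub_ge0. Qed.

Lemma vaddr_ge0 x y : vle 0 x -> vle 0 y -> vle 0 (x + y).
Proof. by move=> x0 y0; rewrite -[X in vle X _](addr0 0); apply: vleD. Qed.

Lemma vle_addr x y : vle 0 y -> vle x (x + y).
Proof. by move=> y0; rewrite -{1}(addr0 x) vle_add2l. Qed.

Lemma vle_addl x y : vle 0 y -> vle x (y + x).
Proof. by rewrite addrC; apply: vle_addr. Qed.

Lemma vscale_ge0 a x : 0 <= a -> vle 0 x -> vle 0 (a *: x).
Proof. by move=> a0 x0; rewrite -(scaler0 _ a); apply: vle_scale. Qed.

Lemma vle_scalel a b x : a <= b -> vle 0 x -> vle (a *: x) (b *: x).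
Proof.
by move=> ab x0; rewrite -vsub_ge0 -scalerBl vscale_ge0 ?subr_ge0.
Qed.

Lemma vle_scale2 a x y : 0 < a -> vle (a *: x) (a *: y) = vle x y.
Proof.
move=> a0; apply/idP/idP; last by apply: vle_scale; apply: ltW.
have ai : 0 <= a^-1 by rewrite invr_ge0 ltW.
move=> h; have := vle_scale _ _ _ ai h.
by rewrite !scalerA mulVf ?gt_eqF// !scale1r.
Qed.

Lemma vsum_ge0 (I : Type) (r : seq I) (P : pred I) (F : I -> E) :
  (forall i, P i -> vle 0 (F i)) -> vle 0 (\sum_(i <- r | P i) F i).
Proof.
move=> F0; elim/big_ind: _ => //; [exact: vle_refl|exact: vaddr_ge0].
Qed.

Lemma vle_sum (I : Type) (r : seq I) (P : pred I) (F G : I -> E) :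
  (forall i, P i -> vle (F i) (G i)) ->
  vle (\sum_(i <- r | P i) F i) (\sum_(i <- r | P i) G i).
Proof.
move=> FG; elim/big_ind2: _ => //; [exact: vle_refl|].
by move=> x1 x2 y1 y2; apply: vleD.
Qed.

Lemma vle_sum_subset (I : finType) (P Q : pred I) (F : I -> E) :
  (forall i, P i -> Q i) -> (forall i, Q i -> vle 0 (F i)) ->
  vle (\sum_(i | P i) F i) (\sum_(i | Q i) F i).
Proof.
move=> PQ F0; rewrite [X in vle _ X](bigID P)/=.
rewrite (eq_bigl P) => [|i]; last first.
  by apply/andP/idP => [[]//|Pi]; split=> //; apply: PQ.
by apply: vle_addr; apply: vsum_ge0 => i /andP[/F0].
Qed.

Lemma vle_joinL x y : vle x (vjoin x y).
Proof. by have := vle_refl (vjoin x y); rewrite vle_joinl => /andP[]. Qed.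

Lemma vle_joinR x y : vle y (vjoin x y).
Proof. by have := vle_refl (vjoin x y); rewrite vle_joinl => /andP[]. Qed.

Lemma vmeet_leL x y : vle (vmeet x y) x.
Proof. by have := vle_refl (vmeet x y); rewrite vle_meetr => /andP[]. Qed.

Lemma vmeet_leR x y : vle (vmeet x y) y.
Proof. by have := vle_refl (vmeet x y); rewrite vle_meetr => /andP[]. Qed.

Lemma vjoin_le x y z : vle x z -> vle y z -> vle (vjoin x y) z.
Proof. by rewrite vle_joinl => -> ->. Qed.

Lemma vle_meet x y z : vle z x -> vle z y -> vle z (vmeet x y).
Proof. by rewrite vle_meetr => -> ->. Qed.

Lemma vmeetC x y : vmeet x y = vmeet y x.
Proof.
by apply: vle_antisym; apply: vle_meet; do ?[exact: vmeet_leL|exact: vmeet_leR].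
Qed.

Lemma vjoinC x y : vjoin x y = vjoin y x.
Proof.
by apply: vle_antisym; apply: vjoin_le; do ?[exact: vle_joinL|exact: vle_joinR].
Qed.

Lemma vmeet_l x y : vle x y -> vmeet x y = x.
Proof.
move=> xy; apply: vle_antisym; first exact: vmeet_leL.
by apply: vle_meet => //; apply: vle_refl.
Qed.

Lemma vjoin_l x y : vle y x -> vjoin x y = x.
Proof.
move=> xy; apply: vle_antisym; last exact: vle_joinL.
by apply: vjoin_le => //; apply: vle_refl.
Qed.

Lemma vmeet_mono x y z t : vle x z -> vle y t -> vle (vmeet x y) (vmeet z t).
Proof.
move=> xz yt; apply: vle_meet.
  exact: vle_trans (vmeet_leL _ _) xz.
exact: vle_trans (vmeet_leR _ _) yt.
Qed.

Lemma vjoin_mono x y z t : vle x z -> vle y t -> vle (vjoin x y) (vjoin z t).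
Proof.
move=> xz yt; apply: vjoin_le.
  exact: vle_trans xz (vle_joinL _ _).
exact: vle_trans yt (vle_joinR _ _).
Qed.

Lemma vmeet_ge0 x y : vle 0 x -> vle 0 y -> vle 0 (vmeet x y).
Proof. exact: vle_meet. Qed.

Lemma vmeetDr z x y : vmeet (x + z) (y + z) = vmeet x y + z.
Proof.
apply: vle_antisym; last first.
  by apply: vle_meet; rewrite vle_add2r; [apply: vmeet_leL|apply: vmeet_leR].
rewrite -vle_subl_addr; apply: vle_meet; rewrite vle_subl_addr.
  exact: vmeet_leL.
exact: vmeet_leR.
Qed.

Lemma vjoinDr z x y : vjoin (x + z) (y + z) = vjoin x y + z.
Proof.
apply: vle_antisym.
  by apply: vjoin_le; rewrite vle_add2r; [apply: vle_joinL|apply: vle_joinR].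
rewrite -vle_subr_addr; apply: vjoin_le; rewrite vle_subr_addr.
  exact: vle_joinL.
exact: vle_joinR.
Qed.

Lemma vmeetN x y : vmeet (- x) (- y) = - vjoin x y.
Proof.
apply: vle_antisym.
  rewrite -vleN2 opprK; apply: vjoin_le; rewrite -vleN2 opprK.
    exact: vmeet_leL.
  exact: vmeet_leR.
by apply: vle_meet; rewrite vleN2; [apply: vle_joinL|apply: vle_joinR].
Qed.

Lemma vjoinDmeet x y : vjoin x y + vmeet x y = x + y.
Proof.
have -> : vmeet x y = - vjoin x y + (x + y); last by rewrite addrA subrr add0r.
by rewrite vjoinC -vmeetN -vmeetDr addKr [x + y]addrC addKr.
Qed.

Lemma vscale_meet a x y : 0 <= a ->
  vmeet (a *: x) (a *: y) = a *: vmeet x y.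
Proof.
rewrite le_eqVlt => /predU1P[<-|a0].
  by rewrite !scale0r; apply: vmeet_l; apply: vle_refl.
apply: vle_antisym; last first.
  by apply: vle_meet; rewrite vle_scale2//; [apply: vmeet_leL|apply: vmeet_leR].
rewrite -(vle_scale2 _ _ (a := a^-1)) ?invr_gt0//.
rewrite scalerA mulVf ?gt_eqF// scale1r.
apply: vle_meet; rewrite -(vle_scale2 _ _ a0) scalerA mulfV ?gt_eqF// scale1r.
  exact: vmeet_leL.
exact: vmeet_leR.
Qed.

Lemma vscale_join a x y : 0 <= a ->
  vjoin (a *: x) (a *: y) = a *: vjoin x y.
Proof.
move=> a0; apply: oppr_inj.
by rewrite -vmeetN -!scalerN vscale_meet// vmeetN scalerN.
Qed.

Lemma vmeet_subadd x y z : vle 0 x -> vle 0 y -> vle 0 z ->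
  vle (vmeet x (y + z)) (vmeet x y + vmeet x z).
Proof.
move=> x0 y0 z0; rewrite -vmeetDr; apply: vle_meet.
  by apply: vle_trans (vmeet_leL _ _) _; apply/vle_addr/vmeet_ge0.
rewrite (addrC y (vmeet _ _)) -vmeetDr; apply: vmeet_mono; last first.
  by rewrite addrC vle_refl.
exact: vle_addr.
Qed.

Lemma vmeet_sum (I : Type) (r : seq I) (P : pred I) (F : I -> E) x :
  vle 0 x -> (forall i, P i -> vle 0 (F i)) ->
  vle (vmeet x (\sum_(i <- r | P i) F i)) (\sum_(i <- r | P i) vmeet x (F i)).
Proof.
move=> x0 F0; elim: r => [|i r IH].
  by rewrite !big_nil; apply: vmeet_leR.
rewrite !big_cons; case: ifPn => // Pi.
apply: vle_trans (vmeet_subadd x0 (F0 i Pi) (vsum_ge0 _ F0)) _.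
by rewrite vle_add2l.
Qed.

Lemma vpos_ge0 x : vle 0 (vpos x).
Proof. exact: vle_joinR. Qed.

Lemma vle_vpos x : vle x (vpos x).
Proof. exact: vle_joinL. Qed.

Lemma vpos_id x : vle 0 x -> vpos x = x.
Proof. exact: vjoin_l. Qed.

Lemma vpos_eq0 x : vle x 0 -> vpos x = 0.
Proof. by move=> x0; rewrite /vpos vjoinC vjoin_l. Qed.

Lemma vpos_mono x y : vle x y -> vle (vpos x) (vpos y).
Proof. by move=> xy; apply: vjoin_mono => //; apply: vle_refl. Qed.

Lemma vsub_meet x y : x - vmeet x y = vpos (x - y).
Proof.
rewrite /vpos -(subrr y) vjoinDr; apply/eqP; rewrite subr_eq addrAC.
by rewrite vjoinDmeet addrK.
Qed.

Lemma vpos_sub_disjoint x y : vmeet (vpos (x - y)) (vpos (y - x)) = 0.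
Proof.
by rewrite -!vsub_meet (vmeetC y x) vmeetDr subrr.
Qed.

Lemma modulus_ge0 x : vle 0 (modulus x).
Proof.
rewrite -(vle_scale2 _ _ (a := 2)) ?ltr0n// scaler0 scaler_nat mulr2n.
rewrite -(subrr x); apply: vleD; [exact: vle_joinL|exact: vle_joinR].
Qed.

Lemma ge0_modulus x : vle 0 x -> modulus x = x.
Proof.
move=> x0; rewrite /modulus vjoin_l//; apply: (vle_trans _ x0).
by rewrite -vsub_ge0 sub0r opprK.
Qed.

Lemma vle_modulus x : vle x (modulus x).
Proof. exact: vle_joinL. Qed.

Lemma modulusN x : modulus (- x) = modulus x.
Proof. by rewrite /modulus opprK vjoinC. Qed.

Lemma modulus_le x y : vle x y -> vle (- x) y -> vle (modulus x) y.
Proof. exact: vjoin_le. Qed.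

Lemma modulusD x y : vle (modulus (x + y)) (modulus x + modulus y).
Proof.
apply: modulus_le; first by apply: vleD; apply: vle_modulus.
by rewrite opprD -(modulusN x) -(modulusN y); apply: vleD; apply: vle_modulus.
Qed.

Lemma modulusZ a x : modulus (a *: x) = `|a| *: modulus x.
Proof.
wlog a0 : a / 0 <= a.
  move=> H; case: (leP 0 a) => [|/ltW a0]; first exact: H.
  by rewrite -modulusN -scaleNr -normrN; apply: H; rewrite oppr_ge0.
by rewrite ger0_norm// /modulus -scalerN vscale_join.
Qed.

Lemma modulus_id x : modulus (modulus x) = modulus x.
Proof. exact/ge0_modulus/modulus_ge0. Qed.

Lemma vpos_lipschitz x y : vle (modulus (vpos x - vpos y)) (modulus (x - y)).
Proof.
have key u v : vle (vpos u - vpos v) (modulus (u - v)).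
  rewrite vle_subl_addr; apply: vjoin_le; last first.
    by apply: vaddr_ge0; [apply: modulus_ge0|apply: vpos_ge0].
  by rewrite -{1}(subrK v u); apply: vleD; [apply: vle_modulus|apply: vle_vpos].
by apply: modulus_le => //; rewrite opprB -modulusN opprB.
Qed.

(** Adding disjoint positive elements amounts to taking their join, by [vjoinDmeet], and a join of
    elements below [y] stays below [y]. *)
Lemma disjoint_sum_le (I : eqType) (r : seq I) (F : I -> E) y :
  uniq r -> vle 0 y -> (forall i, vle 0 (F i)) -> (forall i, vle (F i) y) ->
  (forall i k, i != k -> vmeet (F i) (F k) = 0) ->
  vle (\sum_(i <- r) F i) y.
Proof.
move=> + y0 F0 Fy Fd; elim: r => [|i r IH] /=; first by rewrite big_nil.
case/andP=> ir ru; rewrite big_cons -vjoinDmeet.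
rewrite (_ : vmeet _ _ = 0) ?addr0; first by apply: vjoin_le; rewrite ?IH.
apply: vle_antisym; last by apply: vmeet_ge0 => //; apply: vsum_ge0.
apply: vle_trans (vmeet_sum _ (F0 i) (fun k _ => F0 k)) _.
rewrite big_seq big1 ?vle_refl// => k kr; apply: Fd.
by apply: contraNneq ir => ->.
Qed.

End VectorLatticeTheory.

Section BanachLatticeTheory.
Variables (R : realType) (E : banachLatticeType R).
Implicit Types (x y : E).

Lemma norm_modulus x : `|modulus x| = `|x|.
Proof.
by apply: le_anti; rewrite !lattice_norm// modulus_id vle_refl.
Qed.

Lemma vle_norm x y : vle 0 x -> vle x y -> `|x| <= `|y|.
Proof.
move=> x0 xy; apply: lattice_norm; rewrite !ge0_modulus//.
exact: vle_trans x0 xy.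
Qed.

Lemma norm_vpos_sub x y : `|vpos x - vpos y| <= `|x - y|.
Proof. exact/lattice_norm/vpos_lipschitz. Qed.

End BanachLatticeTheory.

(** * Approximate components *)

Section Hats.
Variables (R : realType) (E : vectorLatticeType R).
Implicit Types (x y z u v w : E).

Lemma disjoint_scale (a b : R) x y : 0 <= a -> 0 <= b -> vle 0 x -> vle 0 y ->
  vmeet x y = 0 -> vmeet (a *: x) (b *: y) = 0.
Proof.
move=> a0 b0 x0 y0 xy; apply: vle_antisym; last first.
  by apply: vmeet_ge0; apply: vscale_ge0.
have c0 : 0 <= Num.max a b by rewrite le_max a0.
rewrite -(scaler0 _ (Num.max a b)) -xy -vscale_meet//.
by apply: vmeet_mono; apply: vle_scalel; rewrite // le_max lexx ?orbT.
Qed.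

Lemma disjoint_mono x y z u : vle 0 x -> vle x z -> vle 0 y -> vle y u ->
  vmeet z u = 0 -> vmeet x y = 0.
Proof.
move=> x0 xz y0 yu zu; apply: vle_antisym; last exact: vmeet_ge0.
by rewrite -zu; apply: vmeet_mono.
Qed.

Lemma disjoint_sum (I : finType) (P Q : pred I) (F : I -> E) :
  (forall i, vle 0 (F i)) ->
  (forall i k, P i -> Q k -> vmeet (F i) (F k) = 0) ->
  vmeet (\sum_(i | P i) F i) (\sum_(i | Q i) F i) = 0.
Proof.
move=> F0 FPQ; have S0 (S : pred I) : vle 0 (\sum_(i | S i) F i).
  exact: vsum_ge0.
apply: vle_antisym; last exact: vmeet_ge0.
apply: vle_trans (vmeet_sum _ (S0 P) (fun k _ => F0 k)) _.
rewrite [X in vle _ X](_ : 0 = \sum_(k | Q k) 0); last by rewrite big1.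
apply: vle_sum => k Qk.
rewrite vmeetC; apply: vle_trans (vmeet_sum _ (F0 k) (fun k _ => F0 k)) _.
rewrite [X in vle _ X](_ : 0 = \sum_(i | P i) 0); last by rewrite big1.
apply: vle_sum => i Pi.
by rewrite vmeetC FPQ// vle_refl.
Qed.

(** Write y = a v as (y meet u) + (y - u)^+. The second summand is disjoint from (u - y)^+, so every
    positive multiple of (u - y)^+ meets y in at most y meet u. *)
Lemma scale_meet_vpos_le (a l : R) u v : 0 <= a -> 0 <= l ->
  vle 0 u -> vle 0 v ->
  vle (a *: vmeet (l *: vpos (u - a *: v)) v) u.
Proof.
move=> a0 l0 u0 v0; rewrite -vscale_meet// scalerA.
set c := a * l; set y := a *: v; set x := c *: _.
have c0 : 0 <= c by apply: mulr_ge0.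
have x0 : vle 0 x by apply/vscale_ge0/vpos_ge0.
have y0 : vle 0 y by apply: vscale_ge0.
have -> : y = vmeet y u + vpos (y - u) by rewrite -vsub_meet addrC subrK.
apply: vle_trans (vmeet_subadd x0 _ (vpos_ge0 _)) _; first exact: vmeet_ge0.
rewrite -[vpos (y - u)]scale1r disjoint_scale ?vpos_ge0// ?vpos_sub_disjoint//.
rewrite addr0; apply: vle_trans (vmeet_leR _ _) _; exact: vmeet_leR.
Qed.

Variables (v w : E) (K : nat).
Hypotheses (w0 : vle 0 w) (wv : vle w v).

Let v0 : vle 0 v. Proof. exact: vle_trans w0 wv. Qed.

(* Reading [w] as [f v] for a function [f] with values in [0, 1], [ramp i] is
   [v] times [K f + 1 - i] truncated to [0, 1], and [hat i] is [v] times the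
   piecewise linear hat function of [K f] centred at [i] with support in
   [i - 1, i + 1]. *)
Let z (i : nat) : E := K%:R *: w + v - i%:R *: v.

Definition ramp (i : nat) : E := vpos (vmeet (z i) v).

Definition hat (i : nat) : E := ramp i - ramp i.+1.

Let zS i : z i.+1 = z i - v.
Proof. by rewrite /z -natr1 scalerDl scale1r opprD !addrA. Qed.

Let z_anti i k : (i <= k)%N -> vle (z k) (z i).
Proof.
by move=> ik; rewrite /z vle_add2l vleN2; apply: vle_scalel; rewrite ?ler_nat.
Qed.

(** Truncating z_i to [0, v] is the same as subtracting (z_i - v)^+ from (z_i)^+, and z_i - v is
    z_(i+1). Sums of ramps therefore telescope, which [sum_hat_weighted] exploits. *)
Let rampE i : ramp i = vpos (z i) - vpos (z i.+1).
Proof.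
rewrite zS -vsub_meet opprB addrA addrAC; set t := vmeet _ _.
have -> : vpos (z i) - z i = vpos (- z i).
  by rewrite /vpos -vjoinDr subrr add0r vjoinC.
have t1 : vle t (z i) by apply: vmeet_leL.
have t2 : vle t v by apply: vmeet_leR.
have -> : vpos (- z i) = vjoin (- t) 0.
  apply: vle_antisym; apply: vjoin_le; rewrite ?vle_joinR//.
    by apply: vle_trans (vle_joinL _ _); rewrite vleN2.
  rewrite -vleN2 opprK -[z i]opprK -vmeetN oppr0 opprK; apply: vmeet_mono => //.
  by rewrite opprK; apply: vle_refl.
by rewrite -vjoinDr addNr add0r vjoinC.
Qed.
Lemma ramp_ge0 i : vle 0 (ramp i). Proof. exact: vpos_ge0. Qed.

Lemma ramp_le i : vle (ramp i) v.
Proof. by apply: vjoin_le => //; apply: vmeet_leR. Qed.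

Lemma ramp_anti i k : (i <= k)%N -> vle (ramp k) (ramp i).
Proof.
by move=> ik; apply/vpos_mono/vmeet_mono; rewrite ?vle_refl// z_anti.
Qed.

Lemma ramp_le_vpos (i l : nat) : (i < l)%N ->
  vle (ramp l) (vpos (K%:R *: w - i%:R *: v)).
Proof.
move=> il; apply: vpos_mono; apply: vle_trans (vmeet_leL _ _) _.
apply: vle_trans (z_anti il) _; rewrite zS /z.
by rewrite addrAC addrK vle_refl.
Qed.

Lemma ramp0 : ramp 0 = v.
Proof.
rewrite /ramp /z scale0r subr0 vmeetC vmeet_l ?vpos_id//.
by apply/vle_addl/vscale_ge0.
Qed.

Let z_end : vle (z K.+1) 0.
Proof.
rewrite zS /z addrAC addrK -vsub_ge0 sub0r opprB -scalerBr.
by apply: vscale_ge0; rewrite ?vsub_ge0.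
Qed.

Lemma ramp_end : ramp K.+1 = 0.
Proof. by apply: vpos_eq0; apply: vle_trans (vmeet_leL _ _) z_end. Qed.

Lemma hat_ge0 i : vle 0 (hat i).
Proof. by rewrite vsub_ge0 ramp_anti. Qed.

Lemma sum_hat : \sum_(i < K.+1) hat i = v.
Proof.
rewrite -(big_mkord xpredT hat) -[RHS]subr0 -[X in _ - X]ramp_end.
rewrite -[X in X - _]ramp0 -opprB.
rewrite -(telescope_sumr ramp)// -sumrN.
by apply: eq_bigr => i _; rewrite opprB.
Qed.

(** Piecewise linear interpolation reproduces the linear function K f. Summation by parts leaves a
    sum of ramps, which telescopes by [rampE]. *)
Lemma sum_hat_weighted : \sum_(i < K.+1) i%:R *: hat i = K%:R *: w.
Proof.
have key n : \sum_(i < n.+1) i%:R *: hat i =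
    vpos (z 1) - vpos (z n.+1) - n%:R *: ramp n.+1.
  elim: n => [|n IH].
    by rewrite big_ord_recl big_ord0 /= !scale0r !subrr addr0.
  rewrite big_ord_recr/= IH /hat scalerBr addrA; congr (_ - _).
  rewrite -[in X in _ + X]natr1 scalerDl scale1r addrA subrK rampE.
  by rewrite addrA subrK.
rewrite key ramp_end scaler0 subr0 (vpos_eq0 z_end) subr0 zS /z scale0r subr0.
by rewrite addrK vpos_id//; apply: vscale_ge0.
Qed.

(** The two hats live on opposite sides of the level (i + 1) / K: the first is below ((i + 1) v - K
    w)^+ and the second below (K w - (i + 1) v)^+. *)
Lemma hat_disjoint i l : (i.+1 < l)%N -> vmeet (hat i) (hat l) = 0.
Proof.
move=> il; apply: disjoint_mono (vpos_sub_disjoint (i.+1%:R *: v) (K%:R *: w)).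
- exact: hat_ge0.
- apply: (@vle_trans _ _ (v - ramp i.+1)).
    by rewrite vle_add2r ramp_le.
  apply: (@vle_trans _ _ (v - vmeet (z i.+1) v)).
    by rewrite vle_add2l vleN2 vle_vpos.
  rewrite vmeetC vsub_meet.
  rewrite (_ : v - z i.+1 = i.+1%:R *: v - K%:R *: w) ?vle_refl//.
  rewrite /z opprB addrCA; congr (_ + _).
  by rewrite opprD addrCA subrr addr0.
- exact: hat_ge0.
- apply: vle_trans (ramp_le_vpos il).
  by rewrite /hat vle_subl_addr; apply/vle_addr/ramp_ge0.
Qed.

End Hats.

(** * Cutting an element at equally spaced levels *)

Section Cut.
Variables (R : realType) (E : vectorLatticeType R).
Variables (v w : E) (N m s : nat).
Hypotheses (w0 : vle 0 w) (wv : vle w v).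
Hypotheses (N0 : (0 < N)%N) (m0 : (0 < m)%N) (sm : (s < m)%N).

Let v0 : vle 0 v. Proof. exact: vle_trans w0 wv. Qed.

Let K := (N * m)%N.

(* The cuts are the indices congruent to [s] modulo [m]; block [k] consists of
   the indices strictly between the cuts [(k - 1) m + s] and [k m + s]. *)
Definition cut_at (i : nat) : bool := ((i + m - s) %% m == 0)%N.

Definition in_block (k i : nat) : bool :=
  ~~ cut_at i && ((i + m - s) %/ m == k)%N.

Definition block (k : nat) : E := \sum_(i < K.+1 | in_block k i) hat v w K i.

Definition cut_remainder : E := \sum_(i < K.+1 | cut_at i) hat v w K i.

Let hat0 i : vle 0 (hat v w K i).
Proof. exact: hat_ge0. Qed.

Let block_partition (F : nat -> E) :
  \sum_(i < K.+1) F i =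
  \sum_(k < N.+1) \sum_(i < K.+1 | in_block k i) F i +
  \sum_(i < K.+1 | cut_at i) F i.
Proof.
rewrite (bigID (fun i : 'I_K.+1 => cut_at i))/= addrC; congr (_ + _).
rewrite (partition_big (fun i : 'I_K.+1 => inord ((i + m - s) %/ m) : 'I_N.+1)
  xpredT)//=.
apply: eq_bigr => k _; apply: eq_bigl => i; rewrite /in_block.
have [//|/= ci] := boolP (cut_at i); rewrite -val_eqE/= inordK//.
have iK : (i <= N * m)%N by rewrite -ltnS.
(* The quotient could reach N + 1 only for i = N m and s = 0, but then i is a cut. *)
rewrite ltn_divLR// ltn_neqAle; apply/andP; split; last first.
  by rewrite mulSn; lia.
by apply: contraNneq ci; rewrite /cut_at => ->; rewrite modnMl.
Qed.

Lemma block_ge0 k : vle 0 (block k).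
Proof. exact: vsum_ge0. Qed.

Lemma cut_remainder_ge0 : vle 0 cut_remainder.
Proof. exact: vsum_ge0. Qed.

Lemma cutE : v = \sum_(k < N.+1) block k + cut_remainder.
Proof. by rewrite -[LHS](sum_hat K w0 wv) block_partition. Qed.

Lemma block_le k : vle (block k) v.
Proof.
rewrite -[X in vle _ X](sum_hat K w0 wv).
exact: (@vle_sum_subset _ _ _ (fun i : 'I_K.+1 => in_block k i)).
Qed.

(** Between indices from different blocks lies a cut, so they are at least two apart and
    [hat_disjoint] applies. *)
Lemma block_disjoint k l : k != l -> vmeet (block k) (block l) = 0.
Proof.
move=> kl.
apply: (@disjoint_sum _ _ _ (fun i : 'I_K.+1 => in_block k i)
  (fun i : 'I_K.+1 => in_block l i)) => // i j.
wlog : k l kl i j / (k < l)%N.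
  move=> H ik jl; move: (kl); rewrite neq_ltn => /orP[]h.
    exact: (H k l kl i j h).
  by rewrite vmeetC; apply: (H l k _ j i h) => //; rewrite eq_sym.
move=> klt /andP[ci /eqP fi] /andP[cj /eqP fj].
apply: hat_disjoint => //.
have := divn_eq (i + m - s) m; have := divn_eq (j + m - s) m.
have := ltn_pmod (i + m - s) m0.
rewrite fi fj; move: ci cj; rewrite /cut_at -!lt0n => ci cj.
have : (k.+1 * m <= l * m)%N by rewrite leq_mul2r klt orbT.
by rewrite mulSn; lia.
Qed.

(** This is the cut that precedes block k. For k = 0 the truncated subtraction gives the least index
    0, because s < m. *)
Definition block_start (k : nat) : nat := k * m + s - m.

Definition block_coef (k : nat) : R := (block_start k)%:R / K%:R.

Let K0 : 0 < K%:R :> R. Proof. by rewrite ltr0n muln_gt0 N0. Qed.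

Lemma block_coef_ge0 k : 0 <= block_coef k.
Proof. by rewrite divr_ge0// ltW. Qed.

Lemma block_coef_le1 k : (k < N.+1)%N -> block_coef k <= 1.
Proof.
rewrite ltnS => kN; rewrite ler_pdivrMr// mul1r ler_nat /block_start.
have : (k * m <= K)%N by rewrite leq_mul2r kN orbT.
by move: sm; clear; lia.
Qed.

Let sum_hat_le_ramp (P : pred nat) a n :
  (forall i, P i -> (a <= i)%N) ->
  vle (\sum_(i < n | P i) hat v w K i) (ramp v w K a).
Proof.
(* Adding the remaining ramp makes the telescoping inductive: a skipped hat is absorbed because the
   ramps decrease. *)
move=> Pa; pose r := ramp v w K (maxn a n).
suff h : vle (\sum_(i < n | P i) hat v w K i + r) (ramp v w K a).
  by apply: vle_trans h; apply/vle_addr/ramp_ge0.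
rewrite /r; elim: n {r} => [|n IH].
  by rewrite big_ord0 add0r maxn0 vle_refl.
rewrite big_mkcond big_ord_recr/= -big_mkcond/=.
apply: vle_trans IH; rewrite -addrA vle_add2l.
have [/Pa an|_] := boolP (P n).
  rewrite (maxn_idPr an) (maxn_idPr (leqW an)) /hat subrK; exact: vle_refl.
rewrite add0r; apply: ramp_anti => //.
by rewrite geq_max !leq_max leqnn/= leqnSn orbT.
Qed.

(** All indices of block k exceed the cut a before it, so the block lies below (K w - a v)^+, and
    [scale_meet_vpos_le] bounds a v by K w there. For a = 0 the claim reduces to 0 <= K w. The
    factor [l] lets multiples of the block exhaust its band. *)
Lemma block_lower k (l : R) : 0 <= l ->
  vle (block_coef k *: vmeet (l *: block k) v) w.
Proof.
move=> l0; rewrite -(vle_scale2 _ _ K0) scalerA mulrC divfK ?gt_eqF//.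
have Kw0 : vle 0 (K%:R *: w) by apply: vscale_ge0.
have [->|a0] := eqVneq (block_start k) 0%N; first by rewrite scale0r.
apply: vle_trans (scale_meet_vpos_le (ler0n _ (block_start k)) l0 Kw0 v0).
apply: vle_scale => //; apply: vmeet_mono; last exact: vle_refl.
apply: vle_scale => //.
apply: (@vle_trans _ _ (ramp v w K (block_start k).+1)); last first.
  exact: ramp_le_vpos.
apply: sum_hat_le_ramp => i /andP[ci /eqP fi].
have := divn_eq (i + m - s) m; rewrite fi.
move: ci a0; rewrite /cut_at -lt0n /block_start => ci a0.
by move: sm; lia.
Qed.

(** An index in block k exceeds [block_start k] by at most m, and m / K = 1 / N gives the error N^-1
    v. Cut indices are at most K, so after division by K they contribute no more than
    [cut_remainder]. *)
Lemma block_upper :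
  vle w (\sum_(k < N.+1) block_coef k *: block k +
         (N%:R^-1 *: v + cut_remainder)).
Proof.
rewrite -(vle_scale2 _ _ K0) -(sum_hat_weighted K w0 wv).
rewrite (block_partition (fun i => i%:R *: hat v w K i)).
rewrite !scalerDr addrA; apply: vleD; last first.
  rewrite /cut_remainder scaler_sumr; apply: vle_sum => i _.
  by apply: vle_scalel => //; rewrite ler_nat -ltnS.
have -> : K%:R *: (N%:R^-1 *: v) = m%:R *: v.
  by rewrite scalerA /K natrM mulrAC mulfV ?mul1r// pnatr_eq0 -lt0n.
apply: (@vle_trans _ _
    (\sum_(k < N.+1) ((block_start k)%:R + m%:R) *: block k)).
  apply: vle_sum => k _; rewrite /block scaler_sumr.
  apply: vle_sum => i /andP[ci /eqP fi].
  apply: vle_scalel => //; rewrite -natrD ler_nat /block_start.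
  have := divn_eq (i + m - s) m; rewrite fi.
  have := ltn_pmod (i + m - s) m0; move: sm; lia.
under eq_bigr do rewrite scalerDl.
rewrite big_split/=; apply: vleD.
  rewrite scaler_sumr; apply: vle_sum => k _.
  by rewrite scalerA mulrC divfK ?gt_eqF// vle_refl.
rewrite -scaler_sumr; apply: vle_scale => //.
rewrite [X in vle _ X]cutE; exact/vle_addr/cut_remainder_ge0.
Qed.

End Cut.

(** Doubling both the modulus and the offset makes every cut even, so the cuts for distinct offsets
    are at least two apart. *)
Lemma cut_remainder_disjoint (R : realType) (E : vectorLatticeType R) (v w : E)
    (N q s t : nat) :
  vle 0 w -> vle w v -> (0 < q)%N -> (s < q)%N -> (t < q)%N -> s != t ->
  vmeet (cut_remainder v w N (q * 2) (s * 2))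
        (cut_remainder v w N (q * 2) (t * 2)) = 0.
Proof.
move=> w0 wv q0 sq tq st.
apply: (@disjoint_sum _ _ _
  (fun i : 'I_(N * (q * 2)).+1 => cut_at (q * 2) (s * 2) i)
  (fun i : 'I_(N * (q * 2)).+1 => cut_at (q * 2) (t * 2) i)) => [i|i j].
  exact: hat_ge0.
rewrite /cut_at => /eqP si /eqP tj.
have := divn_eq (i + q * 2 - s * 2) (q * 2); rewrite si addn0.
set c := (_ %/ _)%N => ci.
have := divn_eq (j + q * 2 - t * 2) (q * 2); rewrite tj addn0.
set d := (_ %/ _)%N => dj.
have : (i.+1 < j)%N || (j.+1 < i)%N.
  have [//|] := boolP (_ || _); rewrite negb_or -!leqNgt => /andP[h1 h2].
  have ij : (c * q + s = d * q + t)%N by lia.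
  have := congr1 (fun n => n %% q)%N ij.
  by rewrite !modnMDl !modn_small// => /eqP; rewrite (negPf st).
by case/orP => h; [|rewrite vmeetC]; apply: hat_disjoint.
Qed.

(** * Real powers *)

Section PowR.
Variable R : realType.
Implicit Types a b p : R.

Lemma powR_mono p a b : 0 <= p -> 0 <= a -> a <= b -> a `^ p <= b `^ p.
Proof.
move=> p0 a0 ab; apply: ge0_ler_powR; rewrite ?nnegrE//.
exact: le_trans ab.
Qed.

Lemma powRVK p a : p != 0 -> 0 <= a -> (a `^ p^-1) `^ p = a.
Proof. by move=> p0 a0; rewrite -powRrM mulVf// powRr1. Qed.

Lemma powRKV p a : p != 0 -> 0 <= a -> (a `^ p) `^ p^-1 = a.
Proof. by move=> p0 a0; rewrite -powRrM mulfV// powRr1. Qed.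

End PowR.

(** * Simultaneous approximation by disjoint pieces *)

Section Approximation.
Variables (R : realType) (E : banachLatticeType R) (p M : R).
Hypotheses (p1 : 1 <= p) (hE : lower_estimate E p M).

Let p0 : 0 < p. Proof. exact: lt_le_trans ltr01 p1. Qed.
Let M0 : 0 < M. Proof. by case: hE. Qed.

(** Being disjoint, the e_t sum up to their join, hence to at most v, so the lower estimate can be
    compared with the norm of v. *)
Lemma lower_estimate_finType (T : finType) (e : T -> E) (v : E) :
  (forall t, vle 0 (e t)) -> (forall t, vle (e t) v) -> vle 0 v ->
  (forall t u, t != u -> vmeet (e t) (e u) = 0) ->
  \sum_t `|e t| `^ p <= (M * `|v|) `^ p.
Proof.
move=> e0 ev v0 ed; case: hE => _ /(_ #|T| (fun i => e (enum_val i))).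
have sumE (V : nmodType) (F : T -> V) :
    \sum_(i < #|T|) F (enum_val i) = \sum_t F t.
  by rewrite -(big_enum_val F).
rewrite (sumE _ (fun t => `|e t| `^ p)) (sumE _ e) => h.
set S := \sum_t _ in h *.
have S0 : 0 <= S by apply: sumr_ge0 => i _; apply: powR_ge0.
have {}h : S `^ p^-1 <= M * `|v|.
  rewrite mulrC -ler_pdivrMr// mulrC; apply: le_trans (h _) _ => [i k ik|].
    rewrite /disjoint_elts !ge0_modulus//; apply: ed.
    by apply: contra ik => /eqP/enum_val_inj ->.
  apply: vle_norm; first exact: vsum_ge0.
  by apply: disjoint_sum_le => //; apply: index_enum_uniq.
rewrite -(powRVK _ S0 (p := p)) ?gt_eqF//.
by apply: powR_mono => //; rewrite ?powR_ge0 ?ltW.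
Qed.

(* The last clause expresses that [w i >= d i t * v] wherever [e t] does not
   vanish. *)
Definition components (v : E) (n : nat) (w : nat -> E) (T : finType)
    (e : T -> E) (d : nat -> T -> R) (r : E) : Prop :=
  [/\ [/\ vle 0 r, vle v (\sum_t e t + r), forall t, vle 0 (e t)
        & forall t, vle (e t) v],
      forall t u, t != u -> vmeet (e t) (e u) = 0,
      forall i t, (i < n)%N -> 0 <= d i t <= 1,
      forall i, (i < n)%N -> vle (w i) (\sum_t d i t *: e t + r)
    & forall i t l, (i < n)%N -> 0 <= l ->
        vle (d i t *: vmeet (l *: e t) v) (w i)].

(** A pigeonhole argument over q offsets: the remainders are disjoint parts of v, so they cannot all
    have norm greater than eta / 2. *)
Lemma components1 (v w : E) (eta : R) : vle 0 w -> vle w v -> 0 < eta ->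
  exists (T : finType) (e : T -> E) (d : T -> R) (r : E),
    components v 1 (fun=> w) e (fun=> d) r /\ `|r| <= eta.
Proof.
move=> w0 wv eta0; have v0 := vle_trans w0 wv.
(* N brings the discretisation error ||v|| / N below eta / 2. The number q is so large that q terms
   of size (eta / 2)^p exceed the bound (M ||v||)^p of the lower estimate. *)
pose N := (Num.bound (`|v| / (eta / 2))).+1.
pose C := (M * `|v|) `^ p; pose D := (eta / 2) `^ p.
pose q := (Num.bound (C / D)).+1.
have D0 : 0 < D by rewrite powR_gt0// divr_gt0.
have qC : C < D * q%:R.
  rewrite mulrC -ltr_pdivrMr//; apply: lt_trans (archi_boundP _) _.
    by rewrite divr_ge0 ?powR_ge0.
  by rewrite ltr_nat.
have Nv : `|v| <= eta / 2 * N%:R.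
  rewrite mulrC -ler_pdivrMr ?divr_gt0//; apply: ltW.
  apply: lt_trans (archi_boundP _) _; last by rewrite ltr_nat.
  by rewrite divr_ge0 ?divr_ge0 // ltW.
have q0 : (0 < q)%N by []. have N0 : (0 < N)%N by [].
pose r (s : 'I_q) := cut_remainder v w N (q * 2) (s * 2).
have r0 s : vle 0 (r s) by exact: cut_remainder_ge0.
have sq (s : 'I_q) : (s * 2 < q * 2)%N by rewrite ltn_pmul2r.
have m0 : (0 < q * 2)%N by rewrite muln_gt0.
have [s rs] : exists s, `|r s| <= eta / 2.
  apply/not_existsP => h.
  suff : C < \sum_s `|r s| `^ p.
    apply/negP; rewrite -leNgt; apply: lower_estimate_finType => //.
      move=> s; rewrite [X in vle _ X](cutE w0 wv N0 m0 (sq s)).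
      by apply/vle_addl/vsum_ge0 => k _; apply: block_ge0.
    move=> s t st; exact: cut_remainder_disjoint.
  apply: lt_le_trans qC _.
  rewrite mulr_natr -[X in _ *+ X]card_ord -sumr_const.
  apply: ler_sum => s _; apply: powR_mono; rewrite ?ltW// ?divr_gt0//.
  by rewrite ltNge; apply/negP/h.
exists 'I_N.+1, (fun k : 'I_N.+1 => block v w N (q * 2) (s * 2) k),
  (fun k : 'I_N.+1 => block_coef R N (q * 2) (s * 2) k), (N%:R^-1 *: v + r s).
split; last first.
  rewrite (splitr eta); apply: le_trans (ler_normD _ _) _; apply: lerD => //.
  by rewrite normrZ ger0_norm ?invr_ge0// mulrC ler_pdivrMr// ltr0n.
have Nv0 : vle 0 (N%:R^-1 *: v) by apply: vscale_ge0; rewrite ?invr_ge0.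
split.
- split.
  + exact: vaddr_ge0.
  + rewrite [X in vle X](cutE w0 wv N0 m0 (sq s)) vle_add2l.
    exact: vle_addl.
  + by move=> t; apply: block_ge0.
  + by move=> t; apply: block_le.
- by move=> t u tu; apply: block_disjoint.
- by move=> _ t _; rewrite block_coef_ge0//= (block_coef_le1 _ N0 m0 (sq s)).
- by move=> _ _; apply: block_upper.
- by move=> _ t l _ l0; apply: block_lower.
Qed.

(** Each e_t is cut by the f_u and by r. The parts of r cut out by the disjoint e_t add up to at
    most r, so a refinement costs a single r, whatever the size of T. *)
Let refine_sum (v : E) (T U : finType) (e : T -> E) (f : U -> E) (r : E)
    (d : T -> R) :
  vle v (\sum_u f u + r) -> vle 0 r -> (forall u, vle 0 (f u)) ->
  (forall t, vle 0 (e t)) -> (forall t, vle (e t) v) ->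
  (forall t s, t != s -> vmeet (e t) (e s) = 0) ->
  (forall t, 0 <= d t <= 1) ->
  vle (\sum_t d t *: e t) (\sum_t \sum_u d t *: vmeet (e t) (f u) + r).
Proof.
move=> vf r0 f0 e0 ev ed d01.
apply: (@vle_trans _ _
  (\sum_t (\sum_u d t *: vmeet (e t) (f u) + vmeet (e t) r))).
  apply: vle_sum => t _; have /andP[d0 d1] := d01 t.
  apply: (@vle_trans _ _ (d t *: (\sum_u vmeet (e t) (f u) + vmeet (e t) r))).
    apply: vle_scale => //; rewrite -{1}(vmeet_l (ev t)).
    apply: vle_trans (vmeet_mono (vle_refl _) vf) _.
    apply: vle_trans (vmeet_subadd _ _ _) _ => //; first exact: vsum_ge0.
    by rewrite vle_add2r; apply: vmeet_sum.
  rewrite scalerDr scaler_sumr vle_add2l -[X in vle _ X]scale1r.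
  by apply: vle_scalel => //; apply: vmeet_ge0.
rewrite big_split/= vle_add2l; apply: disjoint_sum_le => //.
- exact: index_enum_uniq.
- by move=> t; apply: vmeet_ge0.
- by move=> t; apply: vmeet_leR.
- move=> t s ts; apply: disjoint_mono (ed _ _ ts); rewrite ?vmeet_leL//.
    exact: vmeet_ge0.
  exact: vmeet_ge0.
Qed.

(** Induction on n: the meets of the pieces for the first n elements with the pieces for the next
    one form a common refinement, and the two remainders, each of norm at most eta / 2, add up. *)
Lemma components_exist (v : E) (n : nat) (w : nat -> E) (eta : R) :
  vle 0 v -> (forall i, (i < n)%N -> vle 0 (w i)) ->
  (forall i, (i < n)%N -> vle (w i) v) -> 0 < eta ->
  exists (T : finType) (e : T -> E) (d : nat -> T -> R) (r : E),
    components v n w e d r /\ `|r| <= eta.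
Proof.
move=> v0; elim: n eta => [|n IH] eta w0 wv eta0.
  exists unit, (fun=> v), (fun _ _ => 0), 0; split; last by rewrite normr0 ltW.
  split=> //.
  have -> : \sum_(t : unit) v = v by rewrite big_const card_unit /= addr0.
  by rewrite addr0; split=> // *; apply: vle_refl.
have e2 : 0 < eta / 2 by rewrite divr_gt0.
have [T [e [d [r [[[r0 vr e0 ev] ed d01 up lo] re]]]]] :=
  IH _ (fun i ni => w0 i (leqW ni)) (fun i ni => wv i (leqW ni)) e2.
have [U [f [c [r' [[[r'0 vr' f0 fv] fd c01 up' lo'] re']]]]] :=
  components1 (w0 n (leqnn _)) (wv n (leqnn _)) e2.
have ef0 t u : vle 0 (vmeet (e t) (f u)) by apply: vmeet_ge0.
have pairE (a : T -> U -> E) :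
  \sum_(x : T * U) a x.1 x.2 = \sum_t \sum_u a t u by rewrite pair_big.
exists (T * U)%type, (fun x => vmeet (e x.1) (f x.2)),
  (fun i x => if i == n then c x.2 else d i x.1), (r + r'); split; last first.
  by rewrite (splitr eta); apply: le_trans (ler_normD _ _) _; apply: lerD.
split.
- split=> //.
  + exact: vaddr_ge0.
  + apply: vle_trans vr _; rewrite (addrC r) addrA vle_add2r.
    have := refine_sum vr' r'0 f0 e0 ev ed (d := fun=> 1).
    rewrite (pairE (fun t u => vmeet (e t) (f u))).
    under eq_bigr do rewrite scale1r.
    under [in X in vle _ X]eq_bigr do under eq_bigr do rewrite scale1r.
    by apply => _; rewrite ler01 lexx.
  + by move=> x; apply: vle_trans (vmeet_leL _ _) _.
- move=> [t u] [t' u'] /=; rewrite xpair_eqE negb_and => /orP[h|h].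
    by apply: disjoint_mono (ed _ _ h) => //; apply: vmeet_leL.
  by apply: disjoint_mono (fd _ _ h) => //; apply: vmeet_leR.
- move=> i [t u] /=; rewrite ltnS leq_eqVlt; case: eqVneq => /= [_ _|_ ni].
    exact: (c01 0%N).
  exact: d01.
- move=> i; rewrite ltnS leq_eqVlt; case: eqVneq => /= [-> _|_ ni].
    apply: vle_trans (up' 0%N isT) _; rewrite addrA vle_add2r.
    rewrite (pairE (fun t u => c u *: vmeet (e t) (f u))) exchange_big/=.
    under [in X in vle _ X]eq_bigr do under eq_bigr do rewrite vmeetC.
    exact: (refine_sum vr r0 e0 f0 fv fd (fun u => c01 0%N u isT)).
  apply: vle_trans (up i ni) _; rewrite (addrC r) addrA vle_add2r.
  rewrite (pairE (fun t u => d i t *: vmeet (e t) (f u))).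
  exact: (refine_sum vr' r'0 f0 e0 ev ed (fun t => d01 i t ni)).
- move=> i [t u] l /=; rewrite ltnS leq_eqVlt.
  case: eqVneq => /= [-> _ l0|_ ni l0].
    apply: vle_trans (lo' 0%N u l isT l0).
    have /andP[c0 _] := c01 0%N u isT.
    apply: vle_scale => //; apply: vmeet_mono; last exact: vle_refl.
    by apply: vle_scale => //; apply: vmeet_leR.
  apply: vle_trans (lo i t l ni l0).
  have /andP[d0 _] := d01 i t ni.
  apply: vle_scale => //; apply: vmeet_mono; last exact: vle_refl.
  by apply: vle_scale => //; apply: vmeet_leL.
Qed.

End Approximation.

(** * Signed powers and the functional calculus *)

Section SignedPow.
Variables (R : realType).
Implicit Types (x y a p : R).

Lemma signed_pow_ge0 p x : 0 < p -> 0 <= x -> signed_pow x p = x `^ p.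
Proof.
move=> p0; rewrite /signed_pow le_eqVlt => /predU1P[<-|x0].
  by rewrite sgr0 mul0r powR0// gt_eqF.
by rewrite gtr0_sg// mul1r gtr0_norm.
Qed.

Lemma signed_powN p x : signed_pow (- x) p = - signed_pow x p.
Proof. by rewrite /signed_pow sgrN mulNr normrN. Qed.

Lemma signed_pow_lt p : 0 < p -> {homo (@signed_pow R)^~ p : x y / x < y}.
Proof.
move=> p0 x y xy; have [x0|x0] := leP 0 x.
  rewrite !signed_pow_ge0 ?(ltW (le_lt_trans x0 xy))//.
  by apply: gt0_ltr_powR; rewrite ?nnegrE// ltW// (le_lt_trans x0 xy).
rewrite -[X in signed_pow X](opprK x) signed_powN.
rewrite signed_pow_ge0 ?oppr_ge0 1?ltW//.
have x'0 : 0 < (- x) `^ p by rewrite powR_gt0// oppr_gt0.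
have [y0|y0] := leP 0 y.
  rewrite signed_pow_ge0//; apply: (@lt_le_trans _ _ 0); rewrite ?powR_ge0//.
  by rewrite oppr_lt0.
rewrite -[X in signed_pow X](opprK y) signed_powN.
rewrite signed_pow_ge0 ?oppr_ge0 1?ltW//.
by rewrite ltrN2; apply: gt0_ltr_powR; rewrite ?nnegrE ?oppr_ge0 ?ltrN2 1?ltW.
Qed.

Lemma signed_pow_le p : 0 < p -> {mono (@signed_pow R)^~ p : x y / x <= y}.
Proof. by move=> p0; apply: le_mono; apply: signed_pow_lt. Qed.

Lemma signed_powK p : 0 < p ->
  cancel ((@signed_pow R)^~ p) ((@signed_pow R)^~ p^-1).
Proof.
move=> p0 x; wlog x0 : x / 0 <= x.
  move=> H; have [|/ltW x0] := leP 0 x; first exact: H.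
  rewrite -[x in LHS]opprK (signed_powN _ (- x)) signed_powN H ?oppr_ge0//.
  by rewrite opprK.
rewrite (signed_pow_ge0 p0 x0) signed_pow_ge0 ?invr_gt0 ?powR_ge0//.
by rewrite powRKV ?gt_eqF.
Qed.

Lemma signed_powM p a x : 0 < p -> 0 <= a ->
  signed_pow (a * x) p = a `^ p * signed_pow x p.
Proof.
move=> p0; rewrite le_eqVlt => /predU1P[<-|a0].
  by rewrite mul0r powR0 ?gt_eqF// mul0r /signed_pow sgr0 mul0r.
by rewrite /signed_pow sgrM gtr0_sg// mul1r normrM powRM// gtr0_norm// mulrCA.
Qed.

(** A strictly increasing function with an inverse is continuous: the inverse images of the ends of
    an interval around its value at x enclose a neighbourhood of x. *)
Lemma signed_pow_continuous p : 0 < p -> continuous ((@signed_pow R)^~ p).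
Proof.
move=> p0 x; apply/cvgrPdist_lt => e e0.
have pV : cancel ((@signed_pow R)^~ p^-1) ((@signed_pow R)^~ p).
  by move=> y; rewrite -{2}(invrK p) signed_powK// invr_gt0.
have lt1 : signed_pow (signed_pow x p - e) p^-1 < x.
  by rewrite -(leW_mono (signed_pow_le p0)) pV ltrBlDr ltrDl.
have lt2 : x < signed_pow (signed_pow x p + e) p^-1.
  by rewrite -(leW_mono (signed_pow_le p0)) pV ltrDl.
near=> y.
have h1 : signed_pow x p - e < signed_pow y p.
  rewrite -[X in X < _]pV; apply: signed_pow_lt => //.
  by near: y; exact: lt_nbhsr.
have h2 : signed_pow y p < signed_pow x p + e.
  rewrite -[X in _ < X]pV; apply: signed_pow_lt => //.
  by near: y; exact: lt_nbhsl.
by rewrite distrC ltr_distl h1.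
Unshelve. all: by end_near. Qed.

(** Write a^p = a a^(p-1) and likewise for b; as p >= 1, each second factor is at most (a +
    b)^(p-1). *)
Lemma powR_superadditive p a b : 1 <= p -> 0 <= a -> 0 <= b ->
  a `^ p + b `^ p <= (a + b) `^ p.
Proof.
move=> p1 a0 b0; have p0 := lt_le_trans ltr01 p1.
rewrite -!(mulr_powRB1 (p := p))// ?addr_ge0// mulrDl.
apply: lerD; rewrite ler_wpM2l// powR_mono ?subr_ge0 ?addr_ge0//.
  by rewrite lerDl.
by rewrite lerDr.
Qed.

(** If u <= x, superadditivity applies on [x - u, x]; otherwise [x - 2u, x - u] lies on the negative
    side and oddness reduces to the same inequality. The shift by 2u leaves room for both cases. *)
Lemma signed_pow_shift p x u : 1 <= p -> 0 <= u ->
  signed_pow (x - 2 * u) p + u `^ p <= signed_pow x p.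
Proof.
move=> p1 u0; have p0 := lt_le_trans ltr01 p1.
have [ux|xu] := leP u x.
  apply: (@le_trans _ _ (signed_pow (x - u) p + u `^ p)).
    rewrite lerD2r signed_pow_le//.
    by rewrite mulr_natl mulr2n opprD addrA gerDl oppr_le0.
  rewrite !signed_pow_ge0 ?subr_ge0 ?(le_trans u0 ux)//.
  by rewrite -[X in _ <= X `^ _](subrK u) powR_superadditive ?subr_ge0.
apply: (@le_trans _ _ (signed_pow (x - u) p)); last first.
  by rewrite signed_pow_le// gerDl oppr_le0.
rewrite -lerBrDr -lerN2 opprB -!signed_powN !opprB.
have h : 0 <= u - x by rewrite subr_ge0 ltW.
have -> : 2 * u - x = u + (u - x) by rewrite mulr_natl mulr2n addrA.
rewrite !signed_pow_ge0 ?(addr_ge0 u0 h)//.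
exact: powR_superadditive.
Qed.

(** The minorant is built from linear and lattice operations alone, so any functional calculus
    respects it; at y = 0 it leaves x. *)
Lemma signed_pow_sum_ge p x y : 1 <= p ->
  x - 2 * `|y| <= signed_pow (signed_pow x p + signed_pow y p) p^-1.
Proof.
move=> p1; have p0 := lt_le_trans ltr01 p1.
rewrite -[leLHS](signed_powK p0) signed_pow_le ?invr_gt0//.
apply: (@le_trans _ _ (signed_pow x p - `|y| `^ p)).
  by rewrite lerBrDr signed_pow_shift.
rewrite lerD2l -signed_pow_ge0// -signed_powN signed_pow_le//.
by rewrite lerNl -normrN ler_norm.
Qed.

End SignedPow.

Section FunctionalCalculus.
Variables (R : realType) (p : R).
Hypothesis p1 : 1 <= p.

Let p0 : 0 < p. Proof. exact: lt_le_trans ltr01 p1. Qed.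

Lemma cont_homogeneous_coord n (i : 'I_n) :
  cont_homogeneous (fun t : 'rV[R]_n => t ord0 i).
Proof. by split=> [|a t _]; [exact: coord_continuous|rewrite mxE]. Qed.

Lemma cont_homogeneous_lin n (a : R) (f g : 'rV[R]_n -> R) :
  cont_homogeneous f -> cont_homogeneous g ->
  cont_homogeneous (fun t => a * f t + g t).
Proof.
move=> [fc fh] [gc gh]; split=> [t|b t b0].
  have tf : Filter (nbhs t) := nbhs_filter t.
  apply: (@cvgD _ _ _ _ tf _ _ _ _ _ (gc t)).
  exact: (@cvgMl_tmp _ _ _ tf _ _ _ (fc t)).
by rewrite fh// gh// mulrDr mulrCA.
Qed.

Lemma cont_homogeneous_max n (f g : 'rV[R]_n -> R) :
  cont_homogeneous f -> cont_homogeneous g ->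
  cont_homogeneous (fun t => Num.max (f t) (g t)).
Proof.
move=> [fc fh] [gc gh]; split=> [t|b t b0].
  by apply: continuous_max; [exact: fc|exact: gc].
by rewrite fh// gh// maxr_pMr.
Qed.

Lemma cont_homogeneous_pnorm : cont_homogeneous (fun t : 'rV[R]_2 =>
  signed_pow (signed_pow (t ord0 ord0) p + signed_pow (t ord0 ord_max) p) p^-1).
Proof.
split=> [t|a t a0].
  pose s (t : 'rV[R]_2) :=
    signed_pow (t ord0 ord0) p + signed_pow (t ord0 ord_max) p.
  apply: (@continuous_comp _ _ _ s ((@signed_pow R)^~ p^-1)); last first.
    by apply: signed_pow_continuous; rewrite invr_gt0.
  have sc (i : 'I_2) :
      {for t, continuous (fun t : 'rV[R]_2 => signed_pow (t ord0 i) p)}.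
    apply: (@continuous_comp _ _ _ (fun t : 'rV[R]_2 => t ord0 i)
      ((@signed_pow R)^~ p)).
      exact: coord_continuous.
    exact: signed_pow_continuous.
  by apply: (@cvgD _ _ _ _ (nbhs_filter t)); exact: sc.
rewrite !mxE !signed_powM// -mulrDr signed_powM ?invr_gt0 ?powR_ge0//.
by rewrite powRKV ?gt_eqF.
Qed.

(* [f |-> f (1, 0) *: e] is a functional calculus for [(e, 0)], so that [xget]
   picks some functional calculus [tau]; for that [tau] the claim follows from
   [s - 2 |t| <= (s^p + t^p)^(1/p)]. *)
Lemma conc_add0_ge (E : banachLatticeType R) (e : E) :
  vle 0 e -> vle e (conc_add p e 0).
Proof.
move=> e0; rewrite /conc_add /fun_calculus.
set x := (fun i : 'I_2 => _); set F := (fun t : 'rV[R]_2 => _).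
have x0E : x ord0 = e by [].
have x1E : x ord_max = 0 by [].
have ex : [set tau | is_functional_calculus x tau] !=set0.
  pose t0 : 'rV[R]_2 := \row_i (i == ord0)%:R.
  exists (fun f => f t0 *: e); split => [a f g _ _|f g _ _|f g _ _|i].
  - by rewrite scalerDl scalerA.
  - have [fg|/ltW fg] := leP (f t0) (g t0).
      by rewrite vjoinC vjoin_l// vle_scalel.
    by rewrite vjoin_l// vle_scalel.
  - have [fg|/ltW fg] := leP (f t0) (g t0).
      by rewrite vmeet_l// vle_scalel.
    by rewrite vmeetC vmeet_l// vle_scalel.
  - by rewrite mxE /x; case: eqP => _; rewrite ?scale1r ?scale0r.
have := xgetPex (fun=> 0) ex; set tau := xget _ _ => -[lin max _ coord].
pose c0 (t : 'rV[R]_2) := t ord0 ord0.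
pose c1 (t : 'rV[R]_2) := t ord0 ord_max.
have hc0 : cont_homogeneous c0 by exact: cont_homogeneous_coord.
have hc1 : cont_homogeneous c1 by exact: cont_homogeneous_coord.
have hF : cont_homogeneous F by exact: cont_homogeneous_pnorm.
(* This form of -c1 fits the linearity clause, which speaks of a f + g. *)
pose n1 t := -2 * c1 t + c1 t.
have hn1 : cont_homogeneous n1 by exact: cont_homogeneous_lin.
pose m1 t := Num.max (c1 t) (n1 t).
have hm1 : cont_homogeneous m1 by exact: cont_homogeneous_max.
(* As [m1] is the absolute value of [c1], G dominates [c0] by [signed_pow_sum_ge], while [tau] takes
   the same value at G and at F. *)
pose G t := 2 * m1 t + F t.
have hG : cont_homogeneous G by exact: cont_homogeneous_lin.
have tc1 : tau c1 = 0 by rewrite coord.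
have tn1 : tau n1 = 0 by rewrite lin// tc1 scaler0 addr0.
have tm1 : tau m1 = 0 by rewrite max// tc1 tn1 vjoin_l// vle_refl.
have tG : tau G = tau F by rewrite lin// tm1 scaler0 add0r.
have tc0 : tau c0 = e by rewrite coord.
have GE : (fun t => Num.max (G t) (c0 t)) = G.
  apply/funext => t; apply/max_idPl.
  rewrite /G /m1 /n1 addrC -lerBlDr.
  have -> : -2 * c1 t + c1 t = - c1 t.
    by rewrite mulNr mulr_natl mulr2n opprD addrNK.
  have -> : Num.max (c1 t) (- c1 t) = `|c1 t|.
    have [h|/ltW h] := leP 0 (c1 t).
      by rewrite ger0_norm//; apply/max_idPl; rewrite (le_trans _ h)// oppr_le0.
    by rewrite ler0_norm//; apply/max_idPr; rewrite (le_trans h)// oppr_ge0.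
  exact: signed_pow_sum_ge.
have := max _ _ hG hc0; rewrite GE tG tc0 => ->.
exact: vle_joinR.
Qed.

End FunctionalCalculus.

(** * The concavification *)

Section Concavification.
Variables (R : realType) (p M : R) (E : banachLatticeType R).
Hypotheses (p1 : 1 <= p) (hE : lower_estimate E p M).
Variables (Ep : banachLatticeType R) (j : E -> Ep).
Hypothesis hEp : is_concavification_completion p j.

Let p0 : 0 < p. Proof. exact: lt_le_trans ltr01 p1. Qed.
Let M0 : 0 < M. Proof. by case: hE. Qed.

Lemma conc_mapD x y : j (conc_add p x y) = j x + j y.
Proof. by case: hEp => -[]. Qed.

Lemma conc_map_join x y : j (vjoin x y) = vjoin (j x) (j y).
Proof. by case: hEp. Qed.

Lemma conc_map_meet x y : j (vmeet x y) = vmeet (j x) (j y).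
Proof. by case: hEp. Qed.

Lemma conc_mapZ a x : 0 <= a -> j (a *: x) = a `^ p *: j x.
Proof.
move=> a0; case: hEp => -[_ <-] _ _ _ _; rewrite /conc_scale.
by rewrite signed_pow_ge0 ?powR_ge0 ?invr_gt0// powRKV ?gt_eqF.
Qed.

Lemma conc_mapN x : j (- x) = - j x.
Proof.
rewrite -[RHS]scaleN1r; case: hEp => -[_ <-] _ _ _ _.
by rewrite /conc_scale signed_powN signed_pow_ge0 ?invr_gt0// powR1 scaleN1r.
Qed.

Lemma conc_map0 : j 0 = 0.
Proof. by rewrite -(scale0r 0) conc_mapZ// powR0 ?gt_eqF// !scale0r. Qed.

Lemma conc_map_mono x y : vle x y -> vle (j x) (j y).
Proof. by move=> /vmeet_l <-; rewrite conc_map_meet; apply: vmeet_leR. Qed.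

Lemma conc_map_ge0 x : vle 0 x -> vle 0 (j x).
Proof. by move=> x0; rewrite -conc_map0; apply: conc_map_mono. Qed.

Lemma conc_map_vpos x : j (vpos x) = vpos (j x).
Proof. by rewrite /vpos conc_map_join conc_map0. Qed.

Lemma conc_map_modulus x : j (modulus x) = modulus (j x).
Proof. by rewrite /modulus conc_map_join conc_mapN. Qed.

Lemma conc_map_big (s : seq E) :
  j (\big[conc_add p/0]_(y <- s) y) = \sum_(y <- s) j y.
Proof. by rewrite (big_morph j conc_mapD conc_map0). Qed.

Let conc_set (x : E) : set R := [set r | exists v : seq E,
    [/\ forall y, y \in v -> vle 0 y,
        vle (modulus x) (\big[conc_add p/0]_(y <- v) y)
      & r = \sum_(y <- v) `|y| `^ p]].

Let conc_set_mem x : conc_set x (`|x| `^ p).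
Proof.
exists [:: modulus x]; split=> [y|  |].
- by rewrite mem_seq1 => /eqP ->; apply: modulus_ge0.
- rewrite big_cons big_nil; apply: conc_add0_ge => //; exact: modulus_ge0.
- by rewrite big_cons big_nil addr0 norm_modulus.
Qed.

Let conc_set_has_inf x : has_inf (conc_set x).
Proof.
split; first by exists (`|x| `^ p).
exists 0 => _ [v [_ _ ->]]; apply: sumr_ge0 => i _; exact: powR_ge0.
Qed.

Lemma conc_map_norm_le x : `|j x| <= `|x| `^ p.
Proof.
have -> : `|j x| = inf (conc_set x) by case: hEp.
by apply: ge_inf; [case: (conc_set_has_inf x)|].
Qed.

Lemma conc_map_norm_approx x eps : 0 < eps ->
  exists s : seq E, [/\ forall y, y \in s -> vle 0 y,
    vle (modulus (j x)) (\sum_(y <- s) j y)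
  & \sum_(y <- s) `|y| `^ p < `|j x| + eps].
Proof.
move=> e0; have -> : `|j x| = inf (conc_set x) by case: hEp.
have [_ [s [s0 xs ->]] h] := inf_adherent e0 (conc_set_has_inf x).
exists s; split => //.
by rewrite -conc_map_modulus -conc_map_big; apply: conc_map_mono.
Qed.

(** Sums of disjoint positive elements are joins, which j preserves, and a join of positive elements
    is at most their sum. *)
Lemma conc_map_disjoint_sum (T : eqType) (s : seq T) (F : T -> E) :
  uniq s -> (forall t, vle 0 (F t)) ->
  (forall t u, t != u -> vmeet (F t) (F u) = 0) ->
  vle (j (\sum_(t <- s) F t)) (\sum_(t <- s) j (F t)).
Proof.
move=> + F0 Fd; elim: s => [_|t s IH /= /andP[ts us]].
  by rewrite !big_nil conc_map0 vle_refl.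
rewrite !big_cons -vjoinDmeet.
have -> : vmeet (F t) (\sum_(u <- s) F u) = 0.
  apply: vle_antisym; last by apply: vmeet_ge0 => //; apply: vsum_ge0.
  apply: vle_trans (vmeet_sum _ (F0 t) (fun k _ => F0 k)) _.
  rewrite big_seq big1 ?vle_refl// => k ks; apply: Fd.
  by apply: contraNneq ts => ->.
rewrite addr0 conc_map_join; apply: vjoin_le.
  by apply/vle_addr/vsum_ge0 => u _; apply: conc_map_ge0.
by apply: vle_trans (IH us) _; apply/vle_addl/conc_map_ge0.
Qed.

(* [a + r <= max ((1 + th) a) ((1 + 1 / th) r)], and [j] preserves joins. *)
Lemma conc_map_add_le (a r : E) (th : R) : 0 < th -> vle 0 a -> vle 0 r ->
  vle (j (a + r))
      ((1 + th) `^ p *: j a + (1 + th^-1) `^ p *: j r).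
Proof.
move=> th0 a0 r0.
have c0 : 0 < 1 + th by rewrite addr_gt0.
have d0 : 0 < 1 + th^-1 by rewrite addr_gt0// invr_gt0.
set m := vjoin ((1 + th) *: a) ((1 + th^-1) *: r).
have am : vle ((1 + th) *: a) m by apply: vle_joinL.
have rm : vle ((1 + th^-1) *: r) m by apply: vle_joinR.
have le : vle (a + r) m.
  have -> : m = (1 + th)^-1 *: m + (1 + th^-1)^-1 *: m.
    rewrite -scalerDl -[LHS]scale1r; congr (_ *: _).
    by field; rewrite ?gt_eqF//= addrC.
  apply: vleD.
    by rewrite -(vle_scale2 _ _ c0) scalerA mulfV ?gt_eqF// scale1r.
  by rewrite -(vle_scale2 _ _ d0) scalerA mulfV ?gt_eqF// scale1r.
apply: vle_trans (conc_map_mono le) _.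
rewrite /m conc_map_join !conc_mapZ ?ltW//; apply: vjoin_le.
  by apply/vle_addr/vscale_ge0; [exact: powR_ge0|exact: conc_map_ge0].
by apply/vle_addl/vscale_ge0; [exact: powR_ge0|exact: conc_map_ge0].
Qed.

(** The hypothesis turns l u <= y into g l u <= y. If g > 1, starting from u <= y this gives (1 + n
    (g - 1)) u <= y for all n, which is impossible since the norms on the left are unbounded. *)
Lemma local_scaling_le1 (F : banachLatticeType R) (u y : F) (g : R) :
  vle 0 u -> u != 0 -> vle u y -> 
  (forall l, 0 <= l -> vle (g *: vmeet (l *: u) y) y) -> g <= 1.
Proof.
move=> u0 un0 uy h; rewrite leNgt; apply/negP => g1.
have d0 : 0 < g - 1 by rewrite subr_gt0.
have key n : vle ((1 + n%:R * (g - 1)) *: u) y.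
  elim: n => [|n IH]; first by rewrite mul0r addr0 scale1r.
  have l0 : 0 <= 1 + n%:R * (g - 1) by rewrite addr_ge0// mulr_ge0// ltW.
  apply: vle_trans (h _ l0); rewrite vmeet_l// scalerA.
  apply: vle_scalel => //.
  rewrite -natr1; have := mulr_ge0 (ler0n R n) (mulr_ge0 (ltW d0) (ltW d0)).
  by nra.
have nu : 0 < `|u| by rewrite normr_gt0.
pose n := Num.bound (`|y| / ((g - 1) * `|u|)).
have := archi_boundP (divr_ge0 (normr_ge0 y) (mulr_ge0 (ltW d0) (ltW nu))).
rewrite -/n ltr_pdivrMr ?mulr_gt0// => hn.
have l0 : 0 <= 1 + n%:R * (g - 1) by rewrite addr_ge0// mulr_ge0// ltW.
have := vle_norm (vscale_ge0 l0 u0) (key n).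
rewrite normrZ ger0_norm// leNgt => /negP; apply.
by rewrite mulrDl mul1r -mulrA (lt_trans hn)// ltrDr.
Qed.

(** Applying j to the bounds of [components] turns each d_it into d_it^p. The lower bounds on the
    w_i then give sum_i d_it^p <= 1 unless j e_t = 0, the upper bounds control j w_i, and the lower
    estimate for the e_t concludes. *)
Let component_bound (v : E) (n : nat) (w : nat -> E) (th eta : R) :
  0 < th -> 0 < eta -> vle 0 v -> (forall i, (i < n)%N -> vle 0 (w i)) ->
  (forall i, (i < n)%N -> vle (w i) v) ->
  vle (\sum_(i < n) j (w i)) (j v) ->
  \sum_(i < n) `|j (w i)| <=
    (1 + th) `^ p * (M * `|v|) `^ p + n%:R * ((1 + th^-1) `^ p * eta `^ p).
Proof.
move=> th0 eta0 v0 w0 wv wj.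
have [T [e [d [r [[[r0 vr e0 ev] ed d01 up lo] re]]]]] :=
  components_exist p1 hE v0 w0 wv eta0.
have dge i t : (i < n)%N -> 0 <= d i t by move=> /(d01 i t)/andP[].
pose D t := \sum_(i < n) d i t `^ p.
have D1 t : D t * `|j (e t)| <= `|j (e t)|.
  have [->|jn0] := eqVneq (j (e t)) 0; first by rewrite normr0 mulr0.
  rewrite ler_piMl//; apply: (local_scaling_le1 (conc_map_ge0 (e0 t)) jn0
    (conc_map_mono (ev t))) => l l0.
  apply: vle_trans wj; rewrite scaler_suml; apply: vle_sum => i _.
  (* Writing l as the p-th power of l^(1/p) makes the multiple l j e_t the image of l^(1/p) e_t. *)
  rewrite -[l](powRVK _ l0 (p := p)) ?gt_eqF// -conc_mapZ ?powR_ge0//.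
  rewrite -conc_map_meet -conc_mapZ ?dge//.
  by apply: conc_map_mono; apply: lo; rewrite ?powR_ge0.
have jw i : (i < n)%N -> `|j (w i)| <=
    (1 + th) `^ p * \sum_t d i t `^ p * `|j (e t)| +
    (1 + th^-1) `^ p * eta `^ p.
  move=> ni; set a := \sum_t d i t *: e t.
  have a0 : vle 0 a by apply: vsum_ge0 => t _; apply: vscale_ge0; rewrite ?dge.
  have ja : vle (j a) (\sum_t d i t `^ p *: j (e t)).
    apply: vle_trans (conc_map_disjoint_sum (index_enum_uniq T) _ _) _.
    - by move=> t; apply: vscale_ge0; rewrite ?dge.
    - by move=> t u tu; apply: disjoint_scale; rewrite ?dge ?ed.
    by apply: vle_sum => t _; rewrite conc_mapZ ?dge ?vle_refl.
  apply: (@le_trans _ _ `|(1 + th) `^ p *: (\sum_t d i t `^ p *: j (e t)) +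
    (1 + th^-1) `^ p *: j r|).
    apply: vle_norm; first exact/conc_map_ge0/w0.
    apply: vle_trans (conc_map_mono (up i ni)) _.
    apply: vle_trans (conc_map_add_le th0 a0 r0) _.
    by rewrite vle_add2r; apply: vle_scale => //; apply: powR_ge0.
  apply: le_trans (ler_normD _ _) _.
  rewrite !normrZ !(ger0_norm (powR_ge0 _ _)).
  apply: lerD; rewrite ler_wpM2l ?powR_ge0//.
    apply: le_trans (ler_norm_sum _ _ _) _; apply: ler_sum => t _.
    by rewrite normrZ ger0_norm ?powR_ge0.
  by apply: le_trans (conc_map_norm_le r) _; rewrite powR_mono// ltW.
apply: (le_trans (ler_sum _ (fun (i : 'I_n) _ => jw i (ltn_ord i)))).
rewrite big_split/= sumr_const card_ord mulr_natl lerD2r -mulr_sumr.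
rewrite ler_wpM2l ?powR_ge0// exchange_big/=.
apply: le_trans (lower_estimate_finType p1 hE e0 ev v0 ed).
apply: ler_sum => t _; rewrite -mulr_suml; apply: le_trans (D1 t) _.
exact: conc_map_norm_le.
Qed.

Lemma conc_map_sum_norm_le (v : E) (n : nat) (w : nat -> E) :
  vle 0 v -> (forall i, (i < n)%N -> vle 0 (w i)) ->
  vle (\sum_(i < n) j (w i)) (j v) ->
  \sum_(i < n) `|j (w i)| <= (M * `|v|) `^ p.
Proof.
move=> v0 w0 wj.
(* Replacing w_i by w_i meet v does not change its image, because j w_i <= j v. *)
wlog wv : w w0 wj / forall i, (i < n)%N -> vle (w i) v.
  move=> H.
  have wE (i : 'I_n) : j (vmeet (w i) v) = j (w i).
    rewrite conc_map_meet vmeet_l//; apply: vle_trans wj.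
    rewrite (bigD1 i)//=; apply/vle_addr/vsum_ge0 => k _.
    exact/conc_map_ge0/w0.
  under eq_bigr do rewrite -wE.
  apply: (H (fun i => vmeet (w i) v)) => [i ni||i ni]; last exact: vmeet_leR.
    by apply: vmeet_ge0; rewrite ?w0.
  by under eq_bigr do rewrite wE.
set B := (M * `|v|) `^ p; have B0 : 0 <= B by apply: powR_ge0.
apply/ler_addgt0Pr => e' e'0.
(* The parameters are chosen so that (1 + th)^p = 1 + e and the n remainder terms total at most e;
   the bound becomes (1 + e) B + e = B + e'. *)
pose e := e' / (B + 1).
have B1 : 0 < B + 1 by rewrite ltr_pwDr.
have e0 : 0 < e by rewrite divr_gt0.
have pn0 : p != 0 by rewrite gt_eqF.
pose th := (1 + e) `^ p^-1 - 1.
have th1 : (1 + th) `^ p = 1 + e.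
  by rewrite /th addrCA subrr addr0 powRVK// addr_ge0// ltW.
have th0 : 0 < th.
  have -> : 0 < th = (1 `^ p^-1 < (1 + e) `^ p^-1) by rewrite powR1 subr_gt0.
  apply: gt0_ltr_powR; rewrite ?invr_gt0//.
  - by rewrite nnegrE.
  - by rewrite nnegrE addr_ge0// ltW.
  - by rewrite ltrDl.
have d0 : 0 < 1 + th^-1 by rewrite addr_gt0// invr_gt0.
pose eta := (e / n.+1%:R) `^ p^-1 / (1 + th^-1).
have en0 : 0 < e / n.+1%:R by rewrite divr_gt0.
have eta0 : 0 < eta by rewrite divr_gt0// powR_gt0.
have etaE : (1 + th^-1) `^ p * eta `^ p = e / n.+1%:R.
  rewrite -powRM ?ltW// /eta mulrC divfK ?gt_eqF// powRVK//; exact: ltW.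
apply: le_trans (component_bound th0 eta0 v0 w0 wv wj) _.
rewrite -/B th1 etaE.
have -> : e' = e * B + e by rewrite -{2}[e]mulr1 -mulrDr divfK// gt_eqF.
rewrite mulrDl mul1r addrA lerD2l mulrCA ler_piMr ?(ltW e0)//.
by rewrite ler_pdivrMr// mul1r ler_nat.
Qed.

End Concavification.

(** * Riesz decomposition *)

Section RieszDecomposition.
Variables (R : realType) (F : banachLatticeType R) (P : F -> Prop).
Hypotheses (PB : forall a b, P a -> P b -> P (a - b)).
Hypotheses (PI : forall a b, P a -> P b -> P (vmeet a b)).

(** Greedy splitting: from each u the part u meet x goes to x, and the rest (u - x)^+ fits below y.
    The predicate [P] serves to keep the pieces in the range of j. *)
Lemma riesz_decomposition (s : seq F) (x y : F) :
  vle 0 x -> vle 0 y -> P x -> P y ->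
  (forall u, u \in s -> vle 0 u /\ P u) -> \sum_(u <- s) u = x + y ->
  exists s1 s2 : seq F,
  [/\ forall u, u \in s1 -> vle 0 u /\ P u,
      forall u, u \in s2 -> vle 0 u /\ P u,
      \sum_(u <- s1) u = x, \sum_(u <- s2) u = y
    & \sum_(u <- s) `|u| <= \sum_(u <- s1) `|u| + \sum_(u <- s2) `|u|].
Proof.
elim: s x y => [|u s IH] x y x0 y0 Px Py sP.
  rewrite big_nil => xy; exists [::], [::].
  have x00 : x = 0.
    by apply: vle_antisym => //; rewrite xy; apply: vle_addr.
  have y00 : y = 0 by move: xy; rewrite x00 add0r.
  by split; rewrite ?big_nil ?addr0.
rewrite big_cons => sE; have [u0 Pu] := sP u (mem_head u s).
have sP' t : t \in s -> vle 0 t /\ P t.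
  by move=> ts; apply: sP; rewrite inE ts orbT.
have S0 : vle 0 (\sum_(t <- s) t).
  by rewrite big_seq; apply: vsum_ge0 => t /sP'[].
pose a := vmeet u x; pose b := u - a.
have b0 : vle 0 b by rewrite vsub_ge0 vmeet_leL.
have bE : b = vpos (u - x) by rewrite /b vsub_meet.
have by' : vle b y.
  rewrite bE; apply: vjoin_le => //; rewrite vle_subl_addr addrC -sE.
  exact: vle_addr.
have Pa : P a by apply: PI.
have Pb : P b by apply: PB.
have [||||||s1 [s2 [P1 P2 E1 E2 N12]]] := IH (x - a) (y - b).
- by rewrite vsub_ge0 vmeet_leR.
- by rewrite vsub_ge0.
- exact: PB.
- exact: PB.
- exact: sP'.
- by rewrite addrACA -sE -opprD /b addrCA subrr addr0 addrAC subrr add0r.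
exists (a :: s1), (b :: s2); split.
- move=> t; rewrite inE => /predU1P[->|]; last exact: P1.
  by split=> //; apply: vmeet_ge0.
- by move=> t; rewrite inE => /predU1P[->|]; [split|exact: P2].
- by rewrite big_cons E1 addrCA subrr addr0.
- by rewrite big_cons E2 addrCA subrr addr0.
rewrite !big_cons addrACA; apply: lerD => //.
by rewrite -[X in `|X| <= _](subrK a u) addrC ler_normD.
Qed.

End RieszDecomposition.

(** * Sums of norms in the completion *)

Section SumNorms.
Variables (R : realType) (p M : R) (E : banachLatticeType R).
Hypotheses (p1 : 1 <= p) (hE : lower_estimate E p M).
Variables (Ep : banachLatticeType R) (j : E -> Ep).
Hypothesis hEp : is_concavification_completion p j.

Let p0 : 0 < p. Proof. exact: lt_le_trans ltr01 p1. Qed.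
Let M0 : 0 < M. Proof. by case: hE. Qed.

Let rangeB (a b : Ep) : range j a -> range j b -> range j (a - b).
Proof.
move=> [x _ <-] [y _ <-]; exists (conc_add p x (- y)) => //.
by rewrite (conc_mapD hEp) (conc_mapN p1 hEp).
Qed.

Let rangeI (a b : Ep) : range j a -> range j b -> range j (vmeet a b).
Proof.
by move=> [x _ <-] [y _ <-]; exists (vmeet x y); rewrite ?(conc_map_meet hEp).
Qed.

Let range_sum (s : seq E) : range j (\sum_(y <- s) j y).
Proof.
by exists (\big[conc_add p/0]_(y <- s) y); rewrite ?(conc_map_big p1 hEp).
Qed.

(** A preimage of a positive element is made positive by [vpos], with which j commutes. *)
Let range_pos (s : seq Ep) : (forall u, u \in s -> vle 0 u /\ range j u) ->
  exists2 t : seq E, (forall x, x \in t -> vle 0 x) & s = map j t.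
Proof.
elim: s => [|u s IH] sP; first by exists [::].
have [|t t0 ->] := IH; first by move=> v vs; apply: sP; rewrite inE vs orbT.
have [u0 [x _ xu]] := sP u (mem_head u s).
exists (vpos x :: t) => [y|].
  by rewrite inE => /predU1P[->|/t0//]; apply: vpos_ge0.
by rewrite /= (conc_map_vpos p1 hEp) xu vpos_id.
Qed.

Let sum_nthE (V : nmodType) (T : eqType) (x0 : T) (t : seq T) (G : T -> V) :
  \sum_(x <- t) G x = \sum_(i < size t) G (nth x0 t i).
Proof. by rewrite (big_nth x0) big_mkord. Qed.

Let sum_norm_single (s : seq Ep) (v : E) : vle 0 v ->
  (forall u, u \in s -> vle 0 u /\ range j u) ->
  vle (\sum_(u <- s) u) (j v) ->
  \sum_(u <- s) `|u| <= (M * `|v|) `^ p.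
Proof.
move=> v0 /range_pos[t t0 ->]; rewrite !big_map.
rewrite (sum_nthE 0 t j) (sum_nthE 0 t (fun x => `|j x|)) => h.
apply: (conc_map_sum_norm_le p1 hE hEp (w := fun i => nth 0 t i)) => // i it.
by apply: t0; rewrite mem_nth.
Qed.

(** Induction on the cover: S meet j v is handled by the single element v, and the rest (S - j v)^+
    lies below the remaining cover. Riesz decomposition distributes the u over both parts. *)
Let sum_norm_cover (vs : seq E) (s : seq Ep) :
  (forall v, v \in vs -> vle 0 v) ->
  (forall u, u \in s -> vle 0 u /\ range j u) ->
  vle (\sum_(u <- s) u) (\sum_(v <- vs) j v) ->
  \sum_(u <- s) `|u| <= \sum_(v <- vs) (M * `|v|) `^ p.
Proof.
elim: vs s => [|v vs IH] s vs0 sP.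
  rewrite !big_nil => s00.
  suff -> : \sum_(u <- s) `|u| = 0 by [].
  elim: s sP s00 => [|u s IHs] sP; first by rewrite !big_nil.
  have sP' t : t \in s -> vle 0 t /\ range j t.
    by move=> ts; apply: sP; rewrite inE ts orbT.
  have [u0 _] := sP u (mem_head u s).
  have S0 : vle 0 (\sum_(t <- s) t).
    by rewrite big_seq; apply: vsum_ge0 => t /sP'[].
  rewrite !big_cons => us.
  rewrite IHs ?addr0//; last by apply: vle_trans us; apply: vle_addl.
  apply/eqP; rewrite normr_eq0; apply/eqP/vle_antisym => //.
  by apply: vle_trans us; apply: vle_addr.
rewrite !big_cons => h; set S := \sum_(u <- s) u in h.
have v0 : vle 0 v by apply: vs0; rewrite mem_head.
have vs0' t : t \in vs -> vle 0 t by move=> ts; apply: vs0; rewrite inE ts orbT.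
have V0 : vle 0 (\sum_(t <- vs) j t).
  by rewrite big_seq; apply: vsum_ge0 => t /vs0'; apply: (conc_map_ge0 p1 hEp).
have S0 : vle 0 S by rewrite /S big_seq; apply: vsum_ge0 => t /sP[].
have RS : range j S.
  have [t _ st] := range_pos sP; rewrite /S st big_map; exact: range_sum.
have Rv : range j (j v) by exists v.
have jv0 : vle 0 (j v) by apply: (conc_map_ge0 p1 hEp).
have [||||||s1 [s2 [P1 P2 E1 E2 N12]]] :=
  riesz_decomposition rangeB rangeI (s := s) (x := vmeet S (j v))
    (y := S - vmeet S (j v)).
- exact: vmeet_ge0.
- by rewrite vsub_ge0 vmeet_leL.
- exact: rangeI.
- by apply: rangeB => //; apply: rangeI.
- exact: sP.
- by rewrite addrC subrK.
apply: le_trans N12 _; apply: lerD.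
  by apply: sum_norm_single => //; rewrite E1 vmeet_leR.
apply: IH => //; rewrite E2 vsub_meet; apply: vjoin_le => //.
by rewrite vle_subl_addr addrC.
Qed.

(** The sum is some j x, and a cover of x optimal up to e / M^p in the definition of the seminorm
    yields the bound up to e. *)
Let sum_norm_range (s : seq Ep) :
  (forall u, u \in s -> vle 0 u /\ range j u) ->
  \sum_(u <- s) `|u| <= M `^ p * `|\sum_(u <- s) u|.
Proof.
move=> sP; have [t _ st] := range_pos sP.
have [x _ xS] : range j (\sum_(u <- s) u).
  by rewrite st big_map; apply: range_sum.
have S0 : vle 0 (\sum_(u <- s) u).
  by rewrite big_seq; apply: vsum_ge0 => u /sP[].
have Mp0 : 0 < M `^ p by rewrite powR_gt0.
apply/ler_addgt0Pr => e e0.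
have [|vs [vs0 xvs nvs]] := conc_map_norm_approx p1 hEp x (eps := e / M `^ p).
  by rewrite divr_gt0.
apply: (@le_trans _ _ (\sum_(v <- vs) (M * `|v|) `^ p)).
  apply: sum_norm_cover => //; rewrite -xS; apply: vle_trans xvs.
  exact: vle_modulus.
under eq_bigr do rewrite powRM ?normr_ge0 ?(ltW M0)//.
rewrite -mulr_sumr -[X in _ + X](divfK (lt0r_neq0 Mp0)) mulrC.
by rewrite [X in _ <= X + _]mulrC -mulrDl ler_wpM2r ?ltW// -xS.
Qed.

(** Positivity of an approximant is regained by [vpos], which does not increase distances and
    commutes with j. *)
Let dense_pos (u : Ep) (e : R) : vle 0 u -> 0 < e ->
  exists z, [/\ vle 0 z, range j z & `|u - z| < e].
Proof.
move=> u0 e0; case: hEp => _ _ _ _ jd.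
have [||z []] := jd (ball u e); [by exists u; apply: ballxx|exact: ball_open|].
rewrite -ball_normE/= => uz [x _ xz].
exists (vpos z); split; first exact: vpos_ge0.
  by exists (vpos x); rewrite // (conc_map_vpos p1 hEp) xz.
by rewrite -[X in X - _](vpos_id u0); apply: le_lt_trans (norm_vpos_sub _ _) uz.
Qed.

Lemma completion_sum_norm_le (s : seq Ep) : (forall u, u \in s -> vle 0 u) ->
  \sum_(u <- s) `|u| <= M `^ p * `|\sum_(u <- s) u|.
Proof.
move=> s0; have Mp0 : 0 < M `^ p by rewrite powR_gt0.
apply/ler_addgt0Pr => e e0.
(* Replacing every u by f u changes the left side by at most (size s) d and the right side by at
   most M^p (size s) d. The successor in the denominator covers an empty s. *)
pose d := e / ((M `^ p + 1) * (size s).+1%:R).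
have c0 : 0 < (M `^ p + 1) * (size s).+1%:R by rewrite mulr_gt0 ?addr_gt0.
have d0 : 0 < d by rewrite divr_gt0.
have [f fP] : exists f : Ep -> Ep, forall u, vle 0 u ->
    [/\ vle 0 (f u), range j (f u) & `|u - f u| < d].
  have /choice[f fP] : forall u, exists z, vle 0 u ->
      [/\ vle 0 z, range j z & `|u - z| < d].
    move=> u; have [/(dense_pos)/(_ d0)[z hz]|nu] := boolP (vle 0 u).
      by exists z.
    by exists 0 => u0; case/negP: nu.
  by exists f.
have nf u : u \in s -> `|u - f u| <= d.
  by move=> us; have [_ _ /ltW] := fP u (s0 u us).
have h1 : \sum_(u <- s) `|u| <= \sum_(u <- map f s) `|u| + (size s)%:R * d.
  rewrite big_map mulr_natl -[X in _ *+ X]sum1_size -sumrMnr -big_split/=.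
  rewrite big_seq [leRHS]big_seq; apply: ler_sum => u us.
  rewrite mulr1n -lerBlDl; apply: le_trans (nf u us).
  exact: lerB_dist.
have h2 : `|\sum_(u <- map f s) u| <= `|\sum_(u <- s) u| + (size s)%:R * d.
  rewrite big_map -lerBlDl; apply: le_trans (lerB_dist _ _) _.
  rewrite -sumrB; apply: le_trans (ler_norm_sum _ _ _) _.
  rewrite mulr_natl -[X in _ *+ X]sum1_size -sumrMnr.
  rewrite big_seq [leRHS]big_seq; apply: ler_sum => u us.
  by rewrite mulr1n distrC nf.
have h3 : \sum_(u <- map f s) `|u| <= M `^ p * `|\sum_(u <- map f s) u|.
  by apply: sum_norm_range => _ /mapP[u us ->]; have [] := fP u (s0 u us).
apply: le_trans h1 _; apply: le_trans (lerD h3 (lexx _)) _.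
apply: le_trans (lerD (ler_wpM2l (ltW Mp0) h2) (lexx _)) _.
rewrite mulrDr -addrA lerD2l -{2}(mul1r (_ * d)) -mulrDl.
have -> : e = (M `^ p + 1) * ((size s).+1%:R * d).
  by rewrite mulrA mulrC divfK ?gt_eqF.
by rewrite ler_wpM2l ?addr_ge0 ?ler_wpM2r ?ler_nat ?ltW.
Qed.

End SumNorms.

(** * Renorming *)

(** The lower constant is normalised to 1, which also yields definiteness. The upper constant is an
    arbitrary real, so later arguments use its absolute value plus one. *)
Record equivalent_lattice_norm (R : realType) (E : banachLatticeType R) := {
  eqnorm :> E -> R ;
  eqnorm_triangle : forall x y, eqnorm (x + y) <= eqnorm x + eqnorm y ;
  eqnormZ : forall (a : R) x, eqnorm (a *: x) = `|a| * eqnorm x ;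
  eqnorm_mono : forall x y : E, vle (modulus x) (modulus y) ->
    eqnorm x <= eqnorm y ;
  eqnorm_ge : forall x, `|x| <= eqnorm x ;
  eqnorm_bound : R ;
  eqnorm_le : forall x, eqnorm x <= eqnorm_bound * `|x|
}.

Section Renorm.
Variables (R : realType) (E : banachLatticeType R).
Variable N : equivalent_lattice_norm E.

(** The phantom argument allows a second normed structure, depending on the norm, on the carrier of
    E. *)
Definition renormed of equivalent_lattice_norm E : Type := E.

Local Notation F := (renormed N).

HB.instance Definition _ := VectorLattice.on F.

Fact renorm_eq0 (x : F) : N x = 0 -> x = 0.
Proof.
by move=> Nx0; have := eqnorm_ge N x; rewrite Nx0 normr_le0 => /eqP.
Qed.

HB.instance Definition _ := @Lmodule_isNormed.Build R F (N : F -> R)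
  (eqnorm_triangle N) (eqnormZ N) renorm_eq0.

(** A Cauchy filter for the new norm is Cauchy for the old one by [eqnorm_ge], and its limit is a
    limit for the new norm by [eqnorm_le]. *)
Fact renorm_complete (G : set_system F) : ProperFilter G -> cauchy G -> cvg G.
Proof.
move=> FG cG.
have FGE : @ProperFilter E G by exact: FG.
have cE : @cauchy E G.
  apply/cauchy_ballP => e e0.
  move/cauchy_ballP: cG => /(_ e e0); rewrite !near_simpl.
  apply: filterS => -[x y] /=.
  rewrite -!ball_normE /= => h; exact: le_lt_trans (eqnorm_ge N (x - y)) h.
have /cvg_ex[l Gl] := @cauchy_cvg E G FGE cE.
apply/cvg_ex; exists (l : F).
apply/(@fcvgrPdist_lt R F G) => e e0.
pose C := `|eqnorm_bound N| + 1.
have C0 : 0 < C by rewrite ltr_pwDr.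
move/(@fcvgrPdist_lt R E G): Gl => /(_ (e / C) (divr_gt0 e0 C0)).
apply: filterS => y /= ly; apply: le_lt_trans (eqnorm_le N (l - y)) _.
apply: (@le_lt_trans _ _ (C * `|(l : E) - y|)).
  by rewrite ler_wpM2r// /C (le_trans (ler_norm _))// lerDl.
by rewrite mulrC -ltr_pdivlMr.
Qed.

HB.instance Definition _ := Uniform_isComplete.Build F renorm_complete.

Fact renorm_lattice_norm (x y : F) :
  vle (modulus x) (modulus y) -> `|x| <= `|y|.
Proof. exact: (@eqnorm_mono _ _ N). Qed.

HB.instance Definition _ :=
  VectorLattice_isBanachLattice.Build R F renorm_lattice_norm.

Lemma renormed_isomorphic :
  lattice_isomorphic E (F : banachLatticeType R).
Proof.
have C0 : 0 < `|eqnorm_bound N| + 1 by rewrite ltr_pwDr.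
exists (fun x : E => x : F), (fun x : F => x : E); split => //.
split.
- move=> x; apply/(@cvgrPdist_lt R F) => e e0.
  near=> y.
  rewrite (le_lt_trans (eqnorm_le N (x - y)))//.
  rewrite (@le_lt_trans _ _ ((`|eqnorm_bound N| + 1) * `|x - y|))//.
    by rewrite ler_wpM2r// (le_trans (ler_norm _))// lerDl.
  rewrite mulrC -ltr_pdivlMr//.
  near: y; apply: cvgr_dist_lt; [exact: cvg_id|exact: divr_gt0].
- move=> x; have Fx : Filter (nbhs (x : F)) := nbhs_filter (x : F).
  apply/(@cvgrPdist_lt R E F (nbhs (x : F)) Fx) => e e0.
  apply: filterS (@cvgr_dist_lt R F F (nbhs (x : F)) Fx idfun x cvg_id e e0).
  by move=> y; apply: le_lt_trans (eqnorm_ge N (x - y)).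
Unshelve. all: by end_near. Qed.

End Renorm.

(** * The additive norm *)

Section ALNorm.
Variables (R : realType) (F : banachLatticeType R) (C : R).
Hypothesis hC : forall s : seq F, (forall u, u \in s -> vle 0 u) ->
  \sum_(u <- s) `|u| <= C * `|\sum_(u <- s) u|.
Implicit Types x y : F.

(** In analogy with total variation, the supremum of these sums is the least additive function on
    the positive cone that dominates the norm; [hC] makes it finite. *)
Definition decomposition_norms x : set R := [set r | exists s : seq F,
  [/\ forall u, u \in s -> vle 0 u, \sum_(u <- s) u = x
    & r = \sum_(u <- s) `|u|]].

Definition al_norm x : R := sup (decomposition_norms (modulus x)).

Local Notation dn := decomposition_norms.

Lemma dn_mem x : vle 0 x -> dn x `|x|.
Proof.
move=> x0; exists [:: x]; split; rewrite ?big_seq1// => u.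
by rewrite mem_seq1 => /eqP ->.
Qed.

Lemma dn_ub x : ubound (dn x) (C * `|x|).
Proof. by move=> _ [s [s0 <- ->]]; apply: hC. Qed.

Lemma dn_sup x : vle 0 x -> has_sup (dn x).
Proof.
move=> x0; split; first by exists `|x|; exact: dn_mem.
by exists (C * `|x|); exact: dn_ub.
Qed.

Lemma dn_le x r : dn x r -> r <= sup (dn x).
Proof.
by move=> xr; apply: ub_le_sup => //; exists (C * `|x|); exact: dn_ub.
Qed.

(** Riesz decomposition splits a decomposition of x + y without decreasing the sum of norms;
    conversely, decompositions of x and of y concatenate. *)
Lemma dn_supD x y : vle 0 x -> vle 0 y ->
  sup (dn (x + y)) = sup (dn x) + sup (dn y).
Proof.
move=> x0 y0; apply: le_anti; apply/andP; split.
  apply: ge_sup; first by case: (dn_sup (vaddr_ge0 x0 y0)).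
  move=> _ [s [s0 sE ->]].
  have sP u : u \in s -> vle 0 u /\ True by move=> /s0.
  have [s1 [s2 [P1 P2 E1 E2 N12]]] := riesz_decomposition (P := fun=> True)
    (fun _ _ _ _ => I) (fun _ _ _ _ => I) x0 y0 I I sP sE.
  apply: le_trans N12 _; apply: lerD; apply: dn_le.
    by exists s1; split=> // u /P1[].
  by exists s2; split=> // u /P2[].
rewrite -lerBrDr; apply: ge_sup; first by case: (dn_sup x0).
move=> _ [s [s0 sE ->]]; rewrite lerBrDr addrC -lerBrDr.
apply: ge_sup; first by case: (dn_sup y0).
move=> _ [t [t0 tE ->]]; rewrite lerBrDr addrC; apply: dn_le.
exists (s ++ t); split; rewrite ?big_cat ?sE ?tE// => u.
by rewrite mem_cat => /orP[/s0|/t0].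
Qed.

Lemma dn_sup_ge0 x : vle 0 x -> 0 <= sup (dn x).
Proof. by move=> x0; apply: le_trans (dn_le (dn_mem x0)). Qed.

Lemma dn_sup_mono x y : vle 0 x -> vle x y -> sup (dn x) <= sup (dn y).
Proof.
move=> x0 xy; have yx0 : vle 0 (y - x) by rewrite vsub_ge0.
by rewrite -(subrK x y) addrC dn_supD// lerDl dn_sup_ge0.
Qed.

(** Scaling decompositions gives one inequality for every positive factor; the other is the same
    inequality for a^-1. *)
Lemma dn_supZ a x : 0 <= a -> vle 0 x -> sup (dn (a *: x)) = a * sup (dn x).
Proof.
rewrite le_eqVlt => /predU1P[<-|a0] x0.
  rewrite scale0r mul0r; apply: le_anti; apply/andP; split.
    apply: ge_sup; first by case: (dn_sup (vle_refl 0)).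
    by have := @dn_ub 0; rewrite normr0 mulr0.
  by apply: dn_sup_ge0; apply: vle_refl.
have key b z : 0 < b -> vle 0 z -> b * sup (dn z) <= sup (dn (b *: z)).
  move=> b0 z0; rewrite mulrC -ler_pdivlMr//.
  apply: ge_sup; first by case: (dn_sup z0).
  move=> _ [s [s0 sE ->]]; rewrite ler_pdivlMr//; apply: dn_le.
  exists (map (fun u => b *: u) s); split.
  - by move=> _ /mapP[u us ->]; apply: vscale_ge0; [exact: ltW|exact: s0].
  - by rewrite big_map -scaler_sumr sE.
  - rewrite big_map mulr_suml; apply: eq_bigr => u _.
    by rewrite normrZ gtr0_norm// mulrC.
apply: le_anti; rewrite key// andbT.
have ax0 : vle 0 (a *: x) by apply: vscale_ge0 => //; apply: ltW.
have ai : 0 < a^-1 by rewrite invr_gt0.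
have := key _ _ ai ax0.
by rewrite scalerA mulVf ?gt_eqF// scale1r mulrC ler_pdivrMr// mulrC.
Qed.

Lemma al_norm_mono x y : vle (modulus x) (modulus y) -> al_norm x <= al_norm y.
Proof. by apply: dn_sup_mono; apply: modulus_ge0. Qed.

Lemma al_norm_triangle x y : al_norm (x + y) <= al_norm x + al_norm y.
Proof.
rewrite /al_norm -dn_supD ?modulus_ge0//.
by apply: dn_sup_mono; [apply: modulus_ge0|apply: modulusD].
Qed.

Lemma al_normZ a x : al_norm (a *: x) = `|a| * al_norm x.
Proof. by rewrite /al_norm modulusZ dn_supZ ?modulus_ge0. Qed.

Lemma al_norm_ge x : `|x| <= al_norm x.
Proof. by rewrite -norm_modulus; apply/dn_le/dn_mem/modulus_ge0. Qed.

Lemma al_norm_le x : al_norm x <= C * `|x|.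
Proof.
rewrite -norm_modulus; apply: ge_sup; last exact: dn_ub.
by case: (dn_sup (modulus_ge0 x)).
Qed.

Definition al_equivalent_norm : equivalent_lattice_norm F :=
  Build_equivalent_lattice_norm al_norm_triangle al_normZ al_norm_mono
    al_norm_ge al_norm_le.

Lemma al_renorming : exists L : banachLatticeType R,
  is_AL_space L /\ lattice_isomorphic F L.
Proof.
exists (renormed al_equivalent_norm); split; last exact: renormed_isomorphic.
move=> x y x0 y0; change (al_norm x + al_norm y) with (`|x| + `|y|).
change (al_norm (x + y : F) = al_norm x + al_norm y).
rewrite /al_norm !ge0_modulus//; first exact: dn_supD.
exact: vaddr_ge0.
Qed.

End ALNorm.

Theorem theorem10 (R : realType) (p M : R) (E : banachLatticeType R)
    (hp : 1 <= p) (hE : lower_estimate E p M)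
    (Ep : banachLatticeType R) (j : E -> Ep)
    (hEp : is_concavification_completion p j) :
  (exists L : banachLatticeType R,
      is_AL_space L /\ lattice_isomorphic Ep L) /\
  (M = 1 -> is_AL_space Ep).
Proof.
have key := completion_sum_norm_le hp hE hEp.
split; first exact: al_renorming key.
move=> M1 x y x0 y0; apply: le_anti; rewrite ler_normD/=.
(* For two terms and M = 1 the inequality is the reverse of the triangle inequality. *)
have := key [:: x; y]; rewrite !big_cons !big_nil !addr0 M1 powR1 mul1r; apply.
by move=> u; rewrite !inE => /orP[]/eqP ->.
Qed.
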